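(* Any weak equivalence $f: G \to H$ of cosimplicial groupoids induces a weak equivalence of simplicial sets $$f_{\ast}: \mathbf{hom}(\Delta,BG) \to \mathbf{hom}(\Delta,BH).$$
   Context: $\mathbf{\Delta}$ is the category of finite ordinals $\mathbf{n}=\{0,1,\dots,n\}$, $n\ge 0$, and order-preserving functions. A cosimplicial groupoid is a functor $G$ from $\mathbf{\Delta}$ to groupoids, $G^n=G(\mathbf{n})$; a cosimplicial space is a functor from $\mathbf{\Delta}$ to simplicial sets. $BG$ is the cosimplicial space $\mathbf{n}\mapsto B(G^n)$, where $B$ is the nerve. A map of cosimplicial groupoids $G\to H$ is a weak equivalence if each $B(G^n)\to B(H^n)$ is a weak equivalence of simplicial sets. $\Delta$ is the cosimplicial space $\mathbf{n}\mapsto\Delta^n$, and for cosimplicial spaces $X,Y$, $\mathbf{hom}(X,Y)$ is the simplicial set whose $n$-simplices are the cosimplicial space maps $X\times\Delta^n\to Y$. No fibrancy of $BG$ or $BH$ is assumed. *)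

(* Defs.v *)
From HB Require Import structures.
From Stdlib Require Import Relation_Operators.
From mathcomp Require Import all_boot all_order all_algebra.
From mathcomp Require Import generic_quotient.
From mathcomp Require Import all_classical all_reals all_analysis.
Import numFieldNormedType.Exports.
Import Order.TTheory GRing.Theory Num.Theory.

Set Implicit Arguments.
Unset Strict Implicit.
Unset Printing Implicit Defensive.

Local Open Scope classical_set_scope.
Local Open Scope ring_scope.
Local Open Scope quotient_scope.

(* The ordinal n = {0, ..., n} is 'I_n.+1. *)
Record omap (m n : nat) := Omap {
  ofun :> 'I_m.+1 -> 'I_n.+1;
  omap_le : forall i j : 'I_m.+1, (i <= j)%N -> (ofun i <= ofun j)%N }.

Definition id_omap n : omap n n := @Omap n n (fun i => i) (fun _ _ h => h).

Definition comp_omap m n p (g : omap n p) (f : omap m n) : omap m p :=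
  @Omap m p (fun i => g (f i)) (fun i j h => omap_le g (omap_le f h)).

Record sset := SSet {
  simp :> nat -> Type;
  sact : forall m n, omap m n -> simp n -> simp m;
  sact_id : forall n (x : simp n), sact (id_omap n) x = x;
  sact_comp : forall m n p (g : omap n p) (f : omap m n) (x : simp p),
    sact (comp_omap g f) x = sact f (sact g x) }.
Arguments sact {s m n}.

Record smap (X Y : sset) := Smap {
  sfun :> forall n, X n -> Y n;
  smap_nat : forall m n (a : omap m n) (x : X n),
    sfun (sact a x) = sact a (sfun x) }.
Arguments sfun {X Y} s {n}.

Lemma smap_ext (X Y : sset) (f g : smap X Y) :
  (forall n (x : X n), f n x = g n x) -> f = g.
Proof.
case: f g => [f hf] [g hg] /= fg.
have e : f = g by apply: functional_extensionality_dep => n; exact: funext.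
by case: _ / e in hg fg *; rewrite (Prop_irrelevance hf hg).
Qed.

Definition id_smap (X : sset) : smap X X :=
  @Smap X X (fun _ x => x) (fun _ _ _ _ => erefl).

Lemma comp_smap_subproof (X Y Z : sset) (g : smap Y Z) (f : smap X Y)
  m n (a : omap m n) (x : X n) : g m (f m (sact a x)) = sact a (g n (f n x)).
Proof. by rewrite !smap_nat. Qed.

Definition comp_smap (X Y Z : sset) (g : smap Y Z) (f : smap X Y) : smap X Z :=
  Smap (comp_smap_subproof g f).

Definition std_simplex (n : nat) : sset :=
  @SSet (fun m => omap m n) (fun _ _ a x => comp_omap x a)
    (fun _ x => let: Omap _ _ := x in erefl) (fun _ _ _ _ _ _ => erefl).

Definition std_simplex_map m n (a : omap m n) :
    smap (std_simplex m) (std_simplex n) :=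
  @Smap (std_simplex m) (std_simplex n) (fun _ x => comp_omap a x)
    (fun _ _ _ _ => erefl).

Lemma prod_sact_id (X Y : sset) n (z : X n * Y n) :
  (sact (id_omap n) z.1, sact (id_omap n) z.2) = z.
Proof. by case: z => x y; rewrite /= !sact_id. Qed.

Lemma prod_sact_comp (X Y : sset) m n p (g : omap n p) (f : omap m n)
    (z : X p * Y p) :
  (sact (comp_omap g f) z.1, sact (comp_omap g f) z.2) =
  (sact f (sact g z.1), sact f (sact g z.2)).
Proof. by rewrite !sact_comp. Qed.

Definition prod_sset (X Y : sset) : sset :=
  @SSet (fun n => X n * Y n)%type
    (fun _ _ a z => (sact a z.1, sact a z.2))
    (@prod_sact_id X Y) (@prod_sact_comp X Y).

Lemma prod_smap_subproof (X Y X' Y' : sset) (f : smap X X') (g : smap Y Y')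
    m n (a : omap m n) (z : prod_sset X Y n) :
  (f m (sact a z).1, g m (sact a z).2) =
  sact (s := prod_sset X' Y') a (f n z.1, g n z.2).
Proof. by rewrite /= !smap_nat. Qed.

Definition prod_smap (X Y X' Y' : sset) (f : smap X X') (g : smap Y Y') :
    smap (prod_sset X Y) (prod_sset X' Y') :=
  @Smap (prod_sset X Y) (prod_sset X' Y') (fun n z => (f n z.1, g n z.2))
    (prod_smap_subproof f g).

Section homotopy_groups.
Context {R : realType}.

Definition cube n : set 'rV[R]_n := [set s | forall i, 0 <= s ord0 i <= 1].
Arguments cube : clear implicits.

Definition cube_boundary n : set 'rV[R]_n :=
  cube n `&` [set s | exists i, s ord0 i = 0 \/ s ord0 i = 1].
Arguments cube_boundary : clear implicits.

Context {T : topologicalType}.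

(* The maps (I^n, boundary) -> (T, x); their values outside the cube are
   irrelevant. *)
Definition spheroid n (x : T) : set ('rV[R]_n -> T) :=
  [set a | {within cube n, continuous a} /\
           forall s, cube_boundary n s -> a s = x].

(* Homotopy relative to the boundary: for a and b in spheroid n x, this is
   equality of their classes in pi_n(T, x). *)
Definition spheroid_homotopic n (x : T) (a b : 'rV[R]_n -> T) : Prop :=
  exists H : R * 'rV[R]_n -> T,
    [/\ {within `[0, 1] `*` cube n, continuous H},
        forall s, cube n s -> H (0, s) = a s,
        forall s, cube n s -> H (1, s) = b s &
        forall t s, 0 <= t <= 1 -> cube_boundary n s -> H (t, s) = x].

Definition path_joined (x y : T) : Prop :=
  exists2 g : R -> T, {within `[0, 1], continuous g} & g 0 = x /\ g 1 = y.

End homotopy_groups.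
Arguments cube {R} n.
Arguments cube_boundary {R} n.

(* f is bijective on path components and on pi_n at all base points for all
   n >= 1.  The maps induced on homotopy groups are always homomorphisms, so
   bijective means isomorphism. *)
Definition weak_homotopy_equivalence (R : realType) (T U : topologicalType)
    (f : T -> U) : Prop :=
  [/\ continuous f,
      (forall x y, path_joined (R := R) (f x) (f y) ->
         path_joined (R := R) x y),
      (forall y, exists x, path_joined (R := R) (f x) y) &
      forall (n : nat) (x : T), (0 < n)%N ->
        (forall a b : 'rV[R]_n -> T, spheroid x a -> spheroid x b ->
           spheroid_homotopic (f x) (f \o a) (f \o b) ->
           spheroid_homotopic x a b) /\
        (forall c : 'rV[R]_n -> U, spheroid (f x) c ->
           exists2 a, spheroid x a & spheroid_homotopic (f x) (f \o a) c)].

Section realization.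
Context (R : realType).

Definition top_simplex n : set 'rV[R]_n.+1 :=
  [set t | (forall i, 0 <= t ord0 i) /\ \sum_i t ord0 i = 1].
Arguments top_simplex : clear implicits.

Definition top_simplex_push m n (a : omap m n) (t : 'rV[R]_m.+1) :
    'rV[R]_n.+1 := \row_j \sum_(i | a i == j) t ord0 i.

Lemma top_simplex_push_subproof m n (a : omap m n) (t : top_simplex m) :
  top_simplex_push a (set_val t) \in top_simplex n.
Proof.
have /set_mem[t0 t1] := valP t; apply/mem_set; split.
  by move=> j; rewrite mxE sumr_ge0.
rewrite -t1 [RHS](partition_big a xpredT)//=.
by apply: eq_bigr => j _; rewrite mxE.
Qed.

Definition top_simplex_map m n (a : omap m n) (t : top_simplex m) :
    top_simplex n :=
  exist (fun u => u \in top_simplex n) _ (top_simplex_push_subproof a t).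

(* The disjoint union of X_n x |Delta^n|, with X_n discrete. *)
Definition realization_cover (X : sset) :=
  {x : {classic {n : nat & X n}} & top_simplex (projT1 x)}.

Definition cover_pt (X : sset) n (x : X n) (t : top_simplex n) :
    realization_cover X :=
  existT (fun x : {classic {n : nat & X n}} => set_type (top_simplex (projT1 x)))
    (existT _ n x) t.

Variant realization_glue (X : sset) :
    realization_cover X -> realization_cover X -> Prop :=
  RealizationGlue m n (a : omap m n) (x : X n) (t : top_simplex m) :
    realization_glue (cover_pt (sact a x) t) (cover_pt x (top_simplex_map a t)).

Definition realization_rel (X : sset) (p q : realization_cover X) : bool :=
  `[< clos_refl_sym_trans _ (@realization_glue X) p q >].

Lemma realization_rel_refl X : reflexive (@realization_rel X).
Proof. by move=> p; apply/asboolP/rst_refl. Qed.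

Lemma realization_rel_sym X : symmetric (@realization_rel X).
Proof. by move=> p q; apply/asboolP/asboolP; exact: rst_sym. Qed.

Lemma realization_rel_trans X : transitive (@realization_rel X).
Proof.
by move=> q p r /asboolP pq /asboolP qr; apply/asboolP; exact: rst_trans pq qr.
Qed.

Definition realization_equiv (X : sset) :=
  EquivRel (@realization_rel X) (@realization_rel_refl X)
    (@realization_rel_sym X) (@realization_rel_trans X).

Definition realization (X : sset) : topologicalType :=
  quotient_topology {eq_quot (realization_equiv X)}.

Definition realization_pt (X : sset) n (x : X n) (t : top_simplex n) :
    realization X :=
  \pi_({eq_quot (realization_equiv X)}) (cover_pt x t).

Definition realization_map (X Y : sset) (f : smap X Y) (z : realization X) :
    realization Y :=
  let p := repr (z : {eq_quot (realization_equiv X)}) in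
  realization_pt (f _ (projT2 (projT1 p))) (projT2 p).

(* The representative chosen above is immaterial. *)
Lemma realization_map_pt (X Y : sset) (f : smap X Y) n (x : X n)
    (t : top_simplex n) :
  realization_map f (realization_pt x t) = realization_pt (f n x) t.
Proof.
pose F (p : realization_cover X) := cover_pt (f _ (projT2 (projT1 p))) (projT2 p).
pose z : {eq_quot (realization_equiv X)} := realization_pt x t.
suff: realization_rel (F (repr z)) (F (cover_pt x t)) by move=> h; apply/eqquotP.
have : realization_rel (repr z) (cover_pt x t).
  exact/(@eqquotP _ (realization_equiv X))/(reprK z).
move=> /asboolP h; apply/asboolP; elim: h => {z n x t}.
- move=> _ _ [m n a x t]; apply: rst_step; rewrite /F /= smap_nat.
  exact: RealizationGlue.
- by move=> p; exact: rst_refl.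
- by move=> p q _; exact: rst_sym.
- by move=> p q r _ pq _; exact: rst_trans pq.
Qed.

Definition weak_equivalence (X Y : sset) (f : smap X Y) : Prop :=
  weak_homotopy_equivalence R (realization_map f).

End realization.

Record groupoid := Groupoid {
  gob :> Type;
  ghom : gob -> gob -> Type;
  gid : forall x, ghom x x;
  gcomp : forall x y z, ghom y z -> ghom x y -> ghom x z;
  ginv : forall x y, ghom x y -> ghom y x;
  gcompA : forall w x y z (h : ghom y z) (g : ghom x y) (f : ghom w x),
    gcomp h (gcomp g f) = gcomp (gcomp h g) f;
  gid_comp : forall x y (f : ghom x y), gcomp (gid y) f = f;
  gcomp_id : forall x y (f : ghom x y), gcomp f (gid x) = f;
  ginv_comp : forall x y (f : ghom x y), gcomp (ginv f) f = gid x;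
  gcomp_inv : forall x y (f : ghom x y), gcomp f (ginv f) = gid y }.
Arguments gid {_}.
Arguments gcomp {_ x y z}.
Arguments ginv {_ x y}.

Record gfunctor (G H : groupoid) := Gfunctor {
  fob :> G -> H;
  fmor : forall x y : G, ghom x y -> ghom (fob x) (fob y);
  fmor_id : forall x : G, fmor (gid x) = gid (fob x);
  fmor_comp : forall (x y z : G) (g : ghom y z) (f : ghom x y),
    fmor (gcomp g f) = gcomp (fmor g) (fmor f) }.
Arguments fmor {G H} _ {x y}.

Definition id_gfunctor (G : groupoid) : gfunctor G G :=
  @Gfunctor G G (fun x => x) (fun _ _ g => g) (fun=> erefl)
    (fun _ _ _ _ _ => erefl).

Lemma comp_gfunctor_id (G H K : groupoid) (B : gfunctor H K) (A : gfunctor G H)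
  (x : G) : fmor B (fmor A (gid x)) = gid (B (A x)).
Proof. by rewrite !fmor_id. Qed.

Lemma comp_gfunctor_comp (G H K : groupoid) (B : gfunctor H K)
    (A : gfunctor G H) (x y z : G) (g : ghom y z) (f : ghom x y) :
  fmor B (fmor A (gcomp g f)) =
  gcomp (fmor B (fmor A g)) (fmor B (fmor A f)).
Proof. by rewrite !fmor_comp. Qed.

Definition comp_gfunctor (G H K : groupoid) (B : gfunctor H K)
    (A : gfunctor G H) : gfunctor G K :=
  @Gfunctor G K (fun x => B (A x)) (fun _ _ g => fmor B (fmor A g))
    (comp_gfunctor_id B A) (comp_gfunctor_comp B A).

(* The functors from the poset {0, ..., n} to G. *)
Record chain (G : groupoid) (n : nat) := Chain {
  cob : 'I_n.+1 -> G;
  cmor : forall i j : 'I_n.+1, (i <= j)%N -> ghom (cob i) (cob j);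
  cmor_id : forall i : 'I_n.+1, @cmor i i (leqnn i) = gid (cob i);
  cmor_comp : forall (i j k : 'I_n.+1) (ij : (i <= j)%N) (jk : (j <= k)%N)
    (ik : (i <= k)%N), cmor ik = gcomp (cmor jk) (cmor ij) }.

Lemma chain_eq (G : groupoid) n (ob : 'I_n.+1 -> G)
    (mor : forall i j : 'I_n.+1, (i <= j)%N -> ghom (ob i) (ob j)) h1 h1' h2 h2' :
  @Chain G n ob mor h1 h2 = @Chain G n ob mor h1' h2'.
Proof. by rewrite (Prop_irrelevance h1 h1') (Prop_irrelevance h2 h2'). Qed.

Lemma chain_act_id (G : groupoid) m n (a : omap m n) (x : chain G n) (i : 'I_m.+1) :
  cmor x (omap_le a (leqnn i)) = gid (cob x (a i)).
Proof. by rewrite -cmor_id (bool_irrelevance (omap_le _ _) (leqnn (a i))). Qed.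

Definition chain_act (G : groupoid) m n (a : omap m n) (x : chain G n) : chain G m :=
  @Chain G m (fun i => cob x (a i)) (fun i j h => cmor x (omap_le a h))
    (chain_act_id a x)
    (fun i j k ij jk ik =>
       cmor_comp x (omap_le a ij) (omap_le a jk) (omap_le a ik)).

Lemma chain_act_id_omap (G : groupoid) n (x : chain G n) : chain_act (id_omap n) x = x.
Proof. by case: x => *; exact: chain_eq. Qed.

Lemma chain_act_comp_omap (G : groupoid) m n p (g : omap n p) (f : omap m n)
  (x : chain G p) : chain_act (comp_omap g f) x = chain_act f (chain_act g x).
Proof. exact: chain_eq. Qed.

Definition nerve (G : groupoid) : sset :=
  SSet (@chain_act_id_omap G) (@chain_act_comp_omap G).

Lemma chain_map_id (G H : groupoid) (F : gfunctor G H) n (x : chain G n) (i : 'I_n.+1) :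
  fmor F (cmor (i := i) (j := i) x (leqnn i)) = gid (F (cob x i)).
Proof. by rewrite cmor_id fmor_id. Qed.

Lemma chain_map_comp (G H : groupoid) (F : gfunctor G H) n (x : chain G n)
    (i j k : 'I_n.+1) (ij : (i <= j)%N) (jk : (j <= k)%N) (ik : (i <= k)%N) :
  fmor F (cmor x ik) = gcomp (fmor F (cmor x jk)) (fmor F (cmor x ij)).
Proof. by rewrite (cmor_comp x ij jk ik) fmor_comp. Qed.

Definition chain_map (G H : groupoid) (F : gfunctor G H) n (x : chain G n) : chain H n :=
  @Chain H n (fun i => F (cob x i)) (fun _ _ h => fmor F (cmor x h))
    (chain_map_id F x) (chain_map_comp F x).

Definition nerve_map (G H : groupoid) (F : gfunctor G H) : smap (nerve G) (nerve H) :=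
  @Smap (nerve G) (nerve H) (@chain_map G H F)
    (fun _ _ _ _ => @chain_eq _ _ _ _ _ _ _ _).

Record cosimp_groupoid := CosimpGroupoid {
  cg_ob :> nat -> groupoid;
  cg_act : forall m n, omap m n -> gfunctor (cg_ob m) (cg_ob n);
  cg_act_id : forall n, cg_act (id_omap n) = id_gfunctor (cg_ob n);
  cg_act_comp : forall m n p (g : omap n p) (f : omap m n),
    cg_act (comp_omap g f) = comp_gfunctor (cg_act g) (cg_act f) }.
Arguments cg_act c {m n}.

Record cg_map (G H : cosimp_groupoid) := CgMap {
  cg_fun :> forall n, gfunctor (G n) (H n);
  cg_fun_nat : forall m n (a : omap m n),
    comp_gfunctor (cg_fun n) (cg_act G a) =
    comp_gfunctor (cg_act H a) (cg_fun m) }.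

Record cosimp_space := CosimpSpace {
  cs_ob :> nat -> sset;
  cs_act : forall m n, omap m n -> smap (cs_ob m) (cs_ob n);
  cs_act_id : forall n, cs_act (id_omap n) = id_smap (cs_ob n);
  cs_act_comp : forall m n p (g : omap n p) (f : omap m n),
    cs_act (comp_omap g f) = comp_smap (cs_act g) (cs_act f) }.
Arguments cs_act c {m n}.

Record cs_map (X Y : cosimp_space) := CsMap {
  cs_fun :> forall n, smap (X n) (Y n);
  cs_fun_nat : forall m n (a : omap m n),
    comp_smap (cs_fun n) (cs_act X a) = comp_smap (cs_act Y a) (cs_fun m) }.

Lemma cs_map_ext (X Y : cosimp_space) (f g : cs_map X Y) :
  (forall n k (x : X n k), f n k x = g n k x) -> f = g.
Proof.
case: f g => [f hf] [g hg] /= fg.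
have e : f = g.
  by apply: functional_extensionality_dep => n; apply: smap_ext => k x.
by case: _ / e in hg fg *; rewrite (Prop_irrelevance hf hg).
Qed.

Lemma comp_cs_map_nat (X Y Z : cosimp_space) (g : cs_map Y Z) (f : cs_map X Y)
    m n (a : omap m n) :
  comp_smap (comp_smap (g n) (f n)) (cs_act X a) =
  comp_smap (cs_act Z a) (comp_smap (g m) (f m)).
Proof.
apply: smap_ext => k x /=.
have /(congr1 (fun h : smap _ _ => h k x)) /= -> := cs_fun_nat f a.
by have /(congr1 (fun h : smap _ _ => h k (f m k x))) := cs_fun_nat g a.
Qed.

Definition comp_cs_map (X Y Z : cosimp_space) (g : cs_map Y Z)
    (f : cs_map X Y) : cs_map X Z :=
  @CsMap X Z (fun n => comp_smap (g n) (f n)) (comp_cs_map_nat g f).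

Lemma cosimp_nerve_id (G : cosimp_groupoid) n :
  nerve_map (cg_act G (id_omap n)) = id_smap (nerve (G n)).
Proof.
rewrite cg_act_id; apply: smap_ext => k [ob mor h1 h2]; exact: chain_eq.
Qed.

Lemma cosimp_nerve_comp (G : cosimp_groupoid) m n p (g : omap n p)
    (f : omap m n) :
  nerve_map (cg_act G (comp_omap g f)) =
  comp_smap (nerve_map (cg_act G g)) (nerve_map (cg_act G f)).
Proof. by rewrite cg_act_comp; apply: smap_ext => k x; exact: chain_eq. Qed.

Definition cosimp_nerve (G : cosimp_groupoid) : cosimp_space :=
  @CosimpSpace (fun n => nerve (G n)) (fun _ _ a => nerve_map (cg_act G a))
    (cosimp_nerve_id G) (cosimp_nerve_comp G).

Lemma cosimp_nerve_map_nat (G H : cosimp_groupoid) (f : cg_map G H) m n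
    (a : omap m n) :
  comp_smap (nerve_map (f n)) (nerve_map (cg_act G a)) =
  comp_smap (nerve_map (cg_act H a)) (nerve_map (f m)).
Proof.
transitivity (nerve_map (comp_gfunctor (f n) (cg_act G a))).
  by apply: smap_ext => k x; exact: chain_eq.
by rewrite cg_fun_nat; apply: smap_ext => k x; exact: chain_eq.
Qed.

Definition cosimp_nerve_map (G H : cosimp_groupoid) (f : cg_map G H) :
    cs_map (cosimp_nerve G) (cosimp_nerve H) :=
  @CsMap (cosimp_nerve G) (cosimp_nerve H) (fun n => nerve_map (f n))
    (cosimp_nerve_map_nat f).

Definition cg_weak_equivalence (R : realType) (G H : cosimp_groupoid)
    (f : cg_map G H) : Prop :=
  forall n, weak_equivalence R (nerve_map (f n)).

Lemma cosimp_simplex_id n :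
  std_simplex_map (id_omap n) = id_smap (std_simplex n).
Proof. by apply: smap_ext => k []. Qed.

Lemma cosimp_simplex_comp m n p (g : omap n p) (f : omap m n) :
  std_simplex_map (comp_omap g f) =
  comp_smap (std_simplex_map g) (std_simplex_map f).
Proof. exact: smap_ext. Qed.

Definition cosimp_simplex : cosimp_space :=
  CosimpSpace cosimp_simplex_id cosimp_simplex_comp.

Lemma cs_prod_id (X : cosimp_space) (K : sset) n :
  prod_smap (cs_act X (id_omap n)) (id_smap K) = id_smap (prod_sset (X n) K).
Proof. by rewrite cs_act_id; apply: smap_ext => k []. Qed.

Lemma cs_prod_comp (X : cosimp_space) (K : sset) m n p (g : omap n p)
    (f : omap m n) :
  prod_smap (cs_act X (comp_omap g f)) (id_smap K) =
  comp_smap (prod_smap (cs_act X g) (id_smap K))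
            (prod_smap (cs_act X f) (id_smap K)).
Proof. by rewrite cs_act_comp; apply: smap_ext. Qed.

Definition cs_prod (X : cosimp_space) (K : sset) : cosimp_space :=
  @CosimpSpace (fun n => prod_sset (X n) K)
    (fun _ _ a => prod_smap (cs_act X a) (id_smap K))
    (cs_prod_id X K) (cs_prod_comp X K).

Lemma cs_prod_map_nat (X : cosimp_space) (K L : sset) (h : smap K L) m n
    (a : omap m n) :
  comp_smap (prod_smap (id_smap (X n)) h) (cs_act (cs_prod X K) a) =
  comp_smap (cs_act (cs_prod X L) a) (prod_smap (id_smap (X m)) h).
Proof. exact: smap_ext. Qed.

Definition cs_prod_map (X : cosimp_space) (K L : sset) (h : smap K L) :
    cs_map (cs_prod X K) (cs_prod X L) :=
  @CsMap (cs_prod X K) (cs_prod X L) (fun n => prod_smap (id_smap (X n)) h)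
    (cs_prod_map_nat X h).

Section cs_hom.
Context (X Y : cosimp_space).

Definition cs_hom_act m n (a : omap m n)
    (h : cs_map (cs_prod X (std_simplex n)) Y) :
    cs_map (cs_prod X (std_simplex m)) Y :=
  comp_cs_map h (cs_prod_map X (std_simplex_map a)).

Lemma cs_hom_act_id n (h : cs_map (cs_prod X (std_simplex n)) Y) :
  cs_hom_act (id_omap n) h = h.
Proof. by apply: cs_map_ext => k l [x [b hb]]. Qed.

Lemma cs_hom_act_comp m n p (g : omap n p) (f : omap m n)
    (h : cs_map (cs_prod X (std_simplex p)) Y) :
  cs_hom_act (comp_omap g f) h = cs_hom_act f (cs_hom_act g h).
Proof. exact: cs_map_ext. Qed.

Definition cs_hom : sset := SSet cs_hom_act_id cs_hom_act_comp.

End cs_hom.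

Lemma cs_hom_map_nat (X Y Z : cosimp_space) (f : cs_map Y Z) m n
    (a : omap m n) (h : cs_hom X Y n) :
  comp_cs_map f (cs_hom_act a h) = cs_hom_act a (comp_cs_map f h).
Proof. exact: cs_map_ext. Qed.

Definition cs_hom_map (X Y Z : cosimp_space) (f : cs_map Y Z) :
    smap (cs_hom X Y) (cs_hom X Z) :=
  @Smap (cs_hom X Y) (cs_hom X Z) (fun n h => comp_cs_map f h)
    (cs_hom_map_nat f).

(* Main.v *)
(* A levelwise weak equivalence of groupoids is levelwise an equivalence: an
   isomorphism of homotopy groups of classifying spaces in degrees 0 and 1
   forces the functor to be full, faithful and essentially surjective.  This
   uses the covering of BG by the arrows out of an object.  A point of BG is
   regarded as a step function on [0, 1[ (with values the vertices of a
   simplex, on intervals of length the barycentric coordinates); two distinct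
   lifts of a point then differ everywhere, so that agreement up to measure
   less than 1 is a canonical notion of nearby lifts, and paths and homotopies
   lift step by step.

   An n-simplex of hom(Delta, BG) is a family of functors from the
   indiscrete groupoids on [l] x [n] to G^l, natural in l.  Its objects are
   images of objects x_0, ..., x_n of G^0 under the vertex maps, so moving the
   x_j along isomorphisms moves the whole simplex (rebasing), strictly
   compatibly with the cosimplicial structure; this is why no fibrancy is
   needed.  Since f is levelwise fully faithful, a simplex over H whose objects
   in H^0 are isomorphic to objects coming from G^0 can be rebased to a simplex
   over G.  Hence a homotopy inverse of f_*, with homotopies satisfying one
   triangle identity. *)

Require Import Defs.
From Stdlib Require Import Relation_Operators.
From mathcomp Require Import all_boot all_order all_algebra.
From mathcomp Require Import generic_quotient ring lra.
From mathcomp Require Import all_classical all_reals all_analysis.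
Import numFieldNormedType.Exports.
Import Order.TTheory GRing.Theory Num.Theory.
(* [omap] is shadowed by the function of the same name on option types. *)
Import Defs.

Set Implicit Arguments.
Unset Strict Implicit.
Unset Printing Implicit Defensive.

Local Open Scope classical_set_scope.
Local Open Scope ring_scope.
Local Open Scope quotient_scope.

(** * Arrows of groupoids *)

(** The poset [[l] x [n]] has the least element (0, 0), so a functor from it to a groupoid extends
    uniquely to the indiscrete groupoid on its vertices: a simplex is a matrix of arrows whose
    vertices may be repeated and reordered. This freedom yields the homotopies, since a simplex and
    its rebasing are faces of one simplex on twice as many vertices, in which the realization draws
    straight segments. The only choices are made for objects of H^0. All other arrows are then
    forced by full faithfulness, so every identity of simplices follows from the uniqueness of a
    rebasing. The obstacle is that the hypothesis speaks of topological homotopy groups of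
    realizations, so arrows have to be recovered from paths in a quotient space. Barycentric
    coordinates change under the gluing, whereas step functions are only relabelled; this is why
    closeness of lifts is measured on step functions. *)

Lemma existT_inj2 (A : Type) (P : A -> Type) (x : A) (p q : P x) :
  existT P x p = existT P x q -> p = q.
Proof.
move=> e; have := projT2_eq e.
by rewrite (Prop_irrelevance (projT1_eq e) erefl).
Qed.

Section arrows.
Context (G : groupoid).

(** The ends are bundled so that arrows whose ends agree only propositionally can be equated without
    transport. *)
Definition arrow := {x : G & {y : G & ghom x y}}.

Definition arr (x y : G) (h : ghom x y) : arrow :=
  existT _ x (existT (fun y => ghom x y) y h).

Definition src (a : arrow) : G := projT1 a.
Definition tgt (a : arrow) : G := projT1 (projT2 a).
Definition aid (x : G) : arrow := arr (gid x).
Definition ainv (a : arrow) : arrow := arr (ginv (projT2 (projT2 a))).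

(* Total composition; the junk value [a] when [b] and [a] do not compose. *)
Definition acomp (b a : arrow) : arrow :=
  match pselect (tgt a = src b) with
  | left e => arr (gcomp (projT2 (projT2 b))
       (eq_rect (tgt a) (fun z => ghom (src a) z) (projT2 (projT2 a)) _ e))
  | right _ => a
  end.

Lemma arr_inj (x y : G) (h k : ghom x y) : arr h = arr k -> h = k.
Proof. by move=> e; exact: existT_inj2 (existT_inj2 e). Qed.

Lemma arr_srcP (a : arrow) x y : src a = x -> tgt a = y ->
  exists h : ghom x y, a = arr h.
Proof. by case: a => [x' [y' h]] /= <- <-; exists h. Qed.

Lemma acompE x y z (g : ghom y z) (f : ghom x y) :
  acomp (arr g) (arr f) = arr (gcomp g f).
Proof.
rewrite /acomp; case: pselect => // e /=.
by rewrite (Prop_irrelevance e erefl).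
Qed.

Lemma src_ainv a : src (ainv a) = tgt a. Proof. by []. Qed.
Lemma tgt_ainv a : tgt (ainv a) = src a. Proof. by []. Qed.

Lemma src_acomp b a : src (acomp b a) = src a.
Proof. by rewrite /acomp; case: pselect. Qed.

Lemma tgt_acomp b a : tgt a = src b -> tgt (acomp b a) = tgt b.
Proof. by rewrite /acomp; case: pselect. Qed.

Lemma acompA c b a : tgt a = src b -> tgt b = src c ->
  acomp c (acomp b a) = acomp (acomp c b) a.
Proof.
case: a => [x [y f]]; case: b => [y' [z g]]; case: c => [z' [w h]] /= e e'.
case: _ / e in g e' *; case: _ / e' in h *.
by rewrite -!/(arr _) !acompE gcompA.
Qed.

Lemma acomp_idl a x : tgt a = x -> acomp (aid x) a = a.
Proof. by move=> <-; case: a => [? [? f]]; rewrite -!/(arr _) acompE gid_comp. Qed.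

Lemma acomp_idr a x : src a = x -> acomp a (aid x) = a.
Proof. by move=> <-; case: a => [? [? f]]; rewrite -!/(arr _) acompE gcomp_id. Qed.

Lemma acompVl a : acomp (ainv a) a = aid (src a).
Proof. by case: a => [? [? f]]; rewrite -!/(arr _) acompE ginv_comp. Qed.

Lemma acompVr a : acomp a (ainv a) = aid (tgt a).
Proof. by case: a => [? [? f]]; rewrite -!/(arr _) acompE gcomp_inv. Qed.

Lemma acompKl b a : tgt a = src b -> acomp (ainv b) (acomp b a) = a.
Proof. by move=> e; rewrite acompA// acompVl acomp_idl. Qed.

Lemma acompKr b a : tgt a = src b -> acomp (acomp b a) (ainv a) = b.
Proof. by move=> e; rewrite -acompA// acompVr acomp_idr. Qed.

Lemma acompVKl b a : tgt a = tgt b -> acomp b (acomp (ainv b) a) = a.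
Proof. by move=> e; rewrite acompA// acompVr acomp_idl. Qed.

Lemma acomp_injr b b' a : tgt a = src b -> tgt a = src b' ->
  acomp b a = acomp b' a -> b = b'.
Proof. by move=> e e' h; rewrite -(acompKr e) h acompKr. Qed.

Lemma ainvK a : ainv (ainv a) = a.
Proof.
apply: (@acomp_injr _ _ (ainv a)) => //.
by rewrite acompVl acompVr.
Qed.

Lemma ainv_id x : ainv (aid x) = aid x.
Proof. by rewrite -{2}(acompVl (aid x)) acomp_idr. Qed.

Lemma ainv_comp b a : tgt a = src b -> ainv (acomp b a) = acomp (ainv a) (ainv b).
Proof.
move=> e; apply: (@acomp_injr _ _ (acomp b a)).
- by [].
- by rewrite tgt_acomp // src_acomp.
- by rewrite acompVl src_acomp -acompA ?tgt_acomp// acompKl// acompVl.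
Qed.

End arrows.

Section arrow_map.
Context (G H : groupoid) (F : gfunctor G H).

Definition amap (a : arrow G) : arrow H := arr (fmor F (projT2 (projT2 a))).

Lemma amap_arr x y (h : ghom x y) : amap (arr h) = arr (fmor F h).
Proof. by []. Qed.
Lemma src_amap a : src (amap a) = F (src a). Proof. by []. Qed.
Lemma tgt_amap a : tgt (amap a) = F (tgt a). Proof. by []. Qed.

Lemma amap_id x : amap (aid x) = aid (F x).
Proof. by rewrite /aid amap_arr fmor_id. Qed.

Lemma amap_comp b a : tgt a = src b -> amap (acomp b a) = acomp (amap b) (amap a).
Proof.
case: a => [x [y f]]; case: b => [y' [z g]] /= e; case: _ / e in g *.
by rewrite -!/(arr _) acompE !amap_arr fmor_comp acompE.
Qed.

Lemma amap_inv a : amap (ainv a) = ainv (amap a).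
Proof.
apply: (@acomp_injr _ _ _ (amap a)) => //.
by rewrite -amap_comp// !acompVl amap_id.
Qed.

Definition full := forall x y (h : ghom (F x) (F y)), exists k : ghom x y, fmor F k = h.
Definition faithful := forall x y (h k : ghom x y), fmor F h = fmor F k -> h = k.
Definition essentially_surjective := forall y, exists x, inhabited (ghom (F x) y).

Lemma full_arrow : full -> forall x y c, src c = F x -> tgt c = F y ->
  exists a, [/\ src a = x, tgt a = y & amap a = c].
Proof.
move=> fF x y c cx cy; have [h ->] := arr_srcP cx cy.
by have [k e] := fF _ _ h; exists (arr k); rewrite amap_arr e.
Qed.

Lemma faithful_arrow : faithful -> forall a b, src a = src b -> tgt a = tgt b ->
  amap a = amap b -> a = b.
Proof.
move=> fF a b ab ab'; have [h ->] := arr_srcP ab ab'.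
case: b {ab ab'} h => [x [y k]] h e.
by rewrite (fF _ _ h k (arr_inj e)).
Qed.

End arrow_map.

Lemma amap_id_gfunctor (G : groupoid) (a : arrow G) : amap (id_gfunctor G) a = a.
Proof. by case: a => [? []]. Qed.

(* A chain of a groupoid is a functor on the indiscrete groupoid of its
   vertices, so no order between [i] and [j] is required. *)
Definition carr (G : groupoid) n (x : chain G n) (i j : 'I_n.+1) : arrow G :=
  arr (gcomp (cmor x (leq0n j : (@ord0 n <= j)%N))
        (ginv (cmor x (leq0n i : (@ord0 n <= i)%N)))).

Section chains.
Context (G : groupoid).
Implicit Types (n : nat).

Lemma src_carr n (x : chain G n) i j : src (carr x i j) = cob x i.
Proof. by []. Qed.

Lemma tgt_carr n (x : chain G n) i j : tgt (carr x i j) = cob x j.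
Proof. by []. Qed.

Lemma carr_le n (x : chain G n) (i j : 'I_n.+1) (ij : (i <= j)%N) :
  carr x i j = arr (cmor x ij).
Proof.
rewrite /carr (cmor_comp x (leq0n i : (@ord0 n <= i)%N) ij (leq0n j)).
by rewrite -gcompA gcomp_inv gcomp_id.
Qed.

Lemma carr_id n (x : chain G n) i : carr x i i = aid (cob x i).
Proof. by rewrite /carr gcomp_inv. Qed.

Lemma carr_comp n (x : chain G n) i j k :
  acomp (carr x j k) (carr x i j) = carr x i k.
Proof.
rewrite /carr acompE; congr arr.
by rewrite -[X in X = _]gcompA [gcomp (ginv _) (gcomp _ _)]gcompA ginv_comp gid_comp.
Qed.

Lemma carr_inv n (x : chain G n) i j : ainv (carr x i j) = carr x j i.
Proof.
apply: (@acomp_injr _ _ _ (carr x i j)) => //.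
by rewrite acompVl carr_comp carr_id.
Qed.

Lemma carr_act m n (a : omap m n) (x : chain G n) i j :
  carr (chain_act a x) i j = carr x (a i) (a j).
Proof.
wlog ij : i j / (i <= j)%N => [w|].
  have /orP[/w//|/w ji] := leq_total i j.
  by rewrite -carr_inv ji carr_inv.
by rewrite (carr_le _ ij) (carr_le _ (omap_le a ij)).
Qed.

Lemma chain_ext n (x y : chain G n) :
  (forall i j, carr x i j = carr y i j) -> x = y.
Proof.
move=> e; have o : cob x = cob y.
  by apply/funext => i; rewrite -(src_carr x i i) e.
case: x y o e => [ob mor h1 h2] [ob' mor' h1' h2'] /= o.
case: _ / o in mor' h1' h2' * => e.
suff m : mor = mor' by case: _ / m in h1' h2' e *; exact: chain_eq.
apply: functional_extensionality_dep => i.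
apply: functional_extensionality_dep => j.
apply: funext => ij; apply/arr_inj.
by have := e i j; rewrite !(carr_le _ ij).
Qed.

Lemma chain_build n (ob : 'I_n.+1 -> G) (A : 'I_n.+1 -> 'I_n.+1 -> arrow G) :
  (forall i j, src (A i j) = ob i) -> (forall i j, tgt (A i j) = ob j) ->
  (forall i, A i i = aid (ob i)) ->
  (forall i j k, acomp (A j k) (A i j) = A i k) ->
  exists x : chain G n, forall i j, carr x i j = A i j.
Proof.
move=> As At Aid Ac.
have H (p : 'I_n.+1 * 'I_n.+1) : exists h : ghom (ob p.1) (ob p.2), A p.1 p.2 = arr h.
  exact: arr_srcP.
pose m p := projT1 (cid (H p)); have hm p : A p.1 p.2 = arr (m p) := projT2 (cid (H p)).
have h1 i : m (i, i) = gid (ob i) by apply: arr_inj; rewrite -(hm (i, i))/= Aid.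
have h2 i j k : m (i, k) = gcomp (m (j, k)) (m (i, j)).
  apply: arr_inj; rewrite -(acompE (m (j, k)) (m (i, j))).
  by rewrite -(hm (i, j)) -(hm (j, k)) -(hm (i, k))/= Ac.
exists (@Chain G n ob (fun i j _ => m (i, j)) h1 (fun i j k _ _ _ => h2 i j k)).
have inv i j : ainv (A i j) = A j i.
  apply: (@acomp_injr _ _ _ (A i j)); rewrite ?src_ainv ?tgt_ainv ?As ?At//.
  by rewrite acompVl Ac Aid As.
move=> i j; rewrite -(Ac i ord0 j) -(inv ord0 i) /carr /=.
by rewrite (hm (ord0, i)) (hm (ord0, j))/= acompE.
Qed.

End chains.

Lemma carr_map (G H : groupoid) (F : gfunctor G H) n (x : chain G n) i j :
  carr (chain_map F x) i j = amap F (carr x i j).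
Proof.
wlog ij : i j / (i <= j)%N => [w|].
  have /orP[/w//|/w ji] := leq_total i j.
  by rewrite -carr_inv ji -amap_inv carr_inv.
by rewrite !(carr_le _ ij).
Qed.

(** * Simplices of hom(Delta, BG) *)

Lemma omap_ext m n (f g : omap m n) : (forall i, f i = g i) -> f = g.
Proof.
case: f g => [f hf] [g hg] /= /funext e.
by case: _ / e in hg *; rewrite (Prop_irrelevance hf hg).
Qed.

Lemma vertex_omap_subproof n (v : 'I_n.+1) (i j : 'I_1) :
  (i <= j)%N -> (v <= v)%N.
Proof. by []. Qed.

Definition vertex_omap n (v : 'I_n.+1) : omap 0 n :=
  @Omap 0 n (fun=> v) (vertex_omap_subproof v).

Lemma comp_vertex_omap m n (a : omap m n) v :
  comp_omap a (vertex_omap v) = vertex_omap (a v).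
Proof. exact: omap_ext. Qed.

Definition edge_fun n (v : 'I_n.+1) (p : 'I_2) : 'I_n.+1 :=
  if p == ord0 then ord0 else v.

Lemma edge_fun_le n (v : 'I_n.+1) (i j : 'I_2) :
  (i <= j)%N -> (edge_fun v i <= edge_fun v j)%N.
Proof.
rewrite /edge_fun; case: (eqVneq i ord0) => // i0; case: eqVneq => // ->.
by rewrite leqn0 => /eqP i0'; case/eqP: i0; exact: val_inj.
Qed.

Definition edge_omap n (v : 'I_n.+1) : omap 1 n := Omap (edge_fun_le v).

(** [a] preceded by the vertex 0. As (0, 0) is the least vertex of [[l] x [n]], each simplex of the
    product is a face of one that starts there. *)
Definition cone_fun k n (a : omap k n) (p : 'I_k.+2) : 'I_n.+1 :=
  if unlift ord0 p is Some q then a q else ord0.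

Lemma cone_fun_le k n (a : omap k n) (i j : 'I_k.+2) :
  (i <= j)%N -> (cone_fun a i <= cone_fun a j)%N.
Proof.
rewrite /cone_fun; case: unliftP => [i' ->|//]; case: unliftP => [j' ->|->//].
by rewrite !lift0 ltnS; exact: omap_le.
Qed.

Definition cone_omap k n (a : omap k n) : omap k.+1 n := Omap (cone_fun_le a).

Lemma cone_omap_lift k n (a : omap k n) p : cone_omap a (lift ord0 p) = a p.
Proof. by rewrite /= /cone_fun liftK. Qed.

Lemma cone_omap0 k n (a : omap k n) : cone_omap a ord0 = ord0.
Proof. by rewrite /= /cone_fun unlift_none. Qed.

Lemma lift0_omap_le k (i j : 'I_k.+1) :
  (i <= j)%N -> (lift ord0 i <= lift (ord0 : 'I_k.+2) j)%N.
Proof. by rewrite !lift0 ltnS. Qed.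

Definition lift0_omap k : omap k k.+1 := Omap (@lift0_omap_le k).

Lemma comp_cone_lift k n (a : omap k n) : comp_omap (cone_omap a) (lift0_omap k) = a.
Proof. by apply: omap_ext => i; exact: cone_omap_lift. Qed.

Lemma comp_cone_edge k n (a : omap k n) p :
  comp_omap (cone_omap a) (edge_omap (lift ord0 p)) = edge_omap (a p).
Proof.
apply: omap_ext => i /=; rewrite /edge_fun.
by case: eqP => _; [exact: cone_omap0 | exact: cone_omap_lift].
Qed.

Section cells.
Context (G : cosimp_groupoid).
Local Notation T := (cs_hom cosimp_simplex (cosimp_nerve G)).

Definition cell n (phi : T n) l k (a : omap k l) (b : omap k n) : chain (G l) k :=
  @sfun _ _ (cs_fun phi l) k (a, b).

Lemma cell_comp n (phi : T n) l k (a : omap k l) (b : omap k n) k' (c : omap k' k) :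
  cell phi (comp_omap a c) (comp_omap b c) = chain_act c (cell phi a b).
Proof.
exact: (smap_nat (cs_fun phi l) c ((a, b) : prod_sset (std_simplex l) (std_simplex n) k)).
Qed.

Lemma cell_cs_act n (phi : T n) l k (a : omap k l) (b : omap k n) l' (c : omap l l') :
  cell phi (comp_omap c a) b = chain_map (cg_act G c) (cell phi a b).
Proof.
have /(congr1 (fun h : smap (prod_sset (std_simplex l) (std_simplex n)) (nerve (G l')) => h k (a, b))) := cs_fun_nat phi c.
exact.
Qed.

Lemma cell_sact m n (c : omap m n) (phi : T n) l k (a : omap k l) (b : omap k m) :
  cell (sact c phi) a b = cell phi a (comp_omap c b).
Proof. by []. Qed.

Lemma cell_ext n (phi psi : T n) :
  (forall l k (a : omap k l) (b : omap k n), cell phi a b = cell psi a b) -> phi = psi.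
Proof. by move=> e; apply: cs_map_ext => l k [a b]; exact: e. Qed.

Definition cell_edge n (phi : T n) l (u : 'I_l.+1 * 'I_n.+1) : arrow (G l) :=
  carr (cell phi (edge_omap u.1) (edge_omap u.2)) ord0 ord_max.

(** The value at the arrow from [u] to [v] of the indiscrete groupoid. It passes through (0, 0), so
    [u] and [v] need not be comparable. *)
Definition trans n (phi : T n) l (u v : 'I_l.+1 * 'I_n.+1) : arrow (G l) :=
  acomp (cell_edge phi v) (ainv (cell_edge phi u)).

Definition tob n (phi : T n) l (u : 'I_l.+1 * 'I_n.+1) : G l :=
  tgt (cell_edge phi u).

Lemma src_cell_edge n (phi : T n) l (u v : 'I_l.+1 * 'I_n.+1) :
  src (cell_edge phi u) = src (cell_edge phi v).
Proof.
have e (w : 'I_l.+1 * 'I_n.+1) :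
    src (cell_edge phi w) = cob (cell phi (vertex_omap ord0) (vertex_omap ord0)) ord0.
  rewrite src_carr -[LHS]/(cob (chain_act (vertex_omap ord0) _) ord0) -cell_comp.
  by rewrite !comp_vertex_omap.
by rewrite !e.
Qed.

Lemma src_trans n (phi : T n) l (u v : 'I_l.+1 * 'I_n.+1) :
  src (trans phi u v) = tob phi u.
Proof. by rewrite src_acomp. Qed.

Lemma tgt_trans n (phi : T n) l (u v : 'I_l.+1 * 'I_n.+1) :
  tgt (trans phi u v) = tob phi v.
Proof. by rewrite tgt_acomp// tgt_ainv; exact: src_cell_edge. Qed.

Lemma trans_id n (phi : T n) l (u : 'I_l.+1 * 'I_n.+1) :
  trans phi u u = aid (tob phi u).
Proof. by rewrite /trans acompVr. Qed.

Lemma trans_comp n (phi : T n) l (u v w : 'I_l.+1 * 'I_n.+1) :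
  acomp (trans phi v w) (trans phi u v) = trans phi u w.
Proof.
have e := src_cell_edge phi.
rewrite /trans -acompA ?tgt_acomp ?tgt_ainv ?src_acomp ?src_ainv//.
by rewrite (acompA (c := ainv _)) ?tgt_ainv// acompVl acomp_idl// tgt_ainv.
Qed.

(** The cell on the cones over [a] and [b] contains the edges from (0, 0) to both vertices as well
    as the given cell, so its functoriality relates them. *)
Lemma carr_cell n (phi : T n) l k (a : omap k l) (b : omap k n) p q :
  carr (cell phi a b) p q = trans phi (a p, b p) (a q, b q).
Proof.
have e r : carr (cell phi (cone_omap a) (cone_omap b)) ord0 (lift ord0 r) =
    cell_edge phi (a r, b r).
  by rewrite /cell_edge /= -!comp_cone_edge cell_comp carr_act.
rewrite /trans -!e carr_inv carr_comp.
by rewrite -{1}(comp_cone_lift a) -{1}(comp_cone_lift b) cell_comp carr_act.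
Qed.

Lemma trans_ext n (phi psi : T n) :
  (forall l (u v : 'I_l.+1 * 'I_n.+1), trans phi u v = trans psi u v) -> phi = psi.
Proof.
by move=> e; apply: cell_ext => l k a b; apply: chain_ext => p q; rewrite !carr_cell.
Qed.

Lemma trans_inv n (phi : T n) l (u v : 'I_l.+1 * 'I_n.+1) :
  ainv (trans phi u v) = trans phi v u.
Proof. by rewrite /trans ainv_comp ?tgt_ainv ?ainvK//; exact: src_cell_edge. Qed.

Lemma trans_cs_act n (phi : T n) l l' (c : omap l l') (u v : 'I_l.+1 * 'I_n.+1) :
  amap (cg_act G c) (trans phi u v) = trans phi (c u.1, u.2) (c v.1, v.2).
Proof.
(* [c] may move the vertex 0: edges out of (0, 0) go to arrows out of (c 0, 0), a detour that
   cancels in the composite. *)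
have e (w : 'I_l.+1 * 'I_n.+1) : amap (cg_act G c) (cell_edge phi w) =
    trans phi (c ord0, ord0) (c w.1, w.2).
  by rewrite /cell_edge -carr_map -cell_cs_act carr_cell.
rewrite /trans amap_comp ?tgt_ainv; last exact: src_cell_edge.
by rewrite amap_inv !e trans_inv trans_comp.
Qed.

Lemma trans_sact m n (c : omap m n) (phi : T n) l (u v : 'I_l.+1 * 'I_m.+1) :
  trans (sact c phi) u v = trans phi (u.1, c u.2) (v.1, c v.2).
Proof.
by rewrite {1}/trans /cell_edge !cell_sact !carr_cell trans_inv trans_comp.
Qed.

(** With [trans_ext], this identifies the n-simplices of hom(Delta, BG) with families of functors on
    indiscrete groupoids, natural in [l]. *)
Lemma trans_build n (ob : forall l, 'I_l.+1 * 'I_n.+1 -> G l)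
    (A : forall l (u v : 'I_l.+1 * 'I_n.+1), arrow (G l)) :
  (forall l (u v : 'I_l.+1 * 'I_n.+1), src (A l u v) = ob l u) ->
  (forall l (u v : 'I_l.+1 * 'I_n.+1), tgt (A l u v) = ob l v) ->
  (forall l (u : 'I_l.+1 * 'I_n.+1), A l u u = aid (ob l u)) ->
  (forall l (u v w : 'I_l.+1 * 'I_n.+1), acomp (A l v w) (A l u v) = A l u w) ->
  (forall l l' (c : omap l l') (u v : 'I_l.+1 * 'I_n.+1),
     amap (cg_act G c) (A l u v) = A l' (c u.1, u.2) (c v.1, v.2)) ->
  exists phi : T n, forall l (u v : 'I_l.+1 * 'I_n.+1), trans phi u v = A l u v.
Proof.
move=> As At Aid Ac Anat.
have H l k (ab : omap k l * omap k n) : exists x : chain (G l) k,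
    forall p q, carr x p q = A l (ab.1 p, ab.2 p) (ab.1 q, ab.2 q).
  by apply: (@chain_build _ _ (fun p => ob l (ab.1 p, ab.2 p))) => *; rewrite ?Aid.
pose c l k ab := projT1 (cid (H l k ab)).
have hc l k ab p q : carr (c l k ab) p q = A l (ab.1 p, ab.2 p) (ab.1 q, ab.2 q).
  exact: projT2 (cid (H l k ab)) p q.
have c1 l m k (d : omap m k) (ab : prod_sset (std_simplex l) (std_simplex n) k) :
    c l m (sact d ab) = chain_act d (c l k ab).
  by apply: chain_ext => p q; rewrite carr_act !hc.
pose s l : smap (prod_sset (std_simplex l) (std_simplex n)) (nerve (G l)) :=
  @Smap (prod_sset (std_simplex l) (std_simplex n)) (nerve (G l)) (c l) (c1 l).
have s1 l l' (a : omap l l') :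
    comp_smap (s l') (cs_act (cs_prod cosimp_simplex (std_simplex n)) a) =
    comp_smap (cs_act (cosimp_nerve G) a) (s l).
  apply: smap_ext => k ab; apply: chain_ext => p q.
  rewrite [RHS]carr_map.
  by rewrite [LHS]hc hc Anat.
exists (@CsMap (cs_prod cosimp_simplex (std_simplex n)) (cosimp_nerve G) s s1).
move=> l u v; rewrite /trans /cell_edge /cell /= !hc /= /edge_fun /=.
rewrite -(Ac l u (ord0, ord0) v).
have inv w w' : ainv (A l w w') = A l w' w.
  apply: (@acomp_injr _ _ _ (A l w w')); rewrite ?src_ainv ?tgt_ainv ?As ?At//.
  by rewrite acompVl Ac Aid As.
by rewrite inv -!surjective_pairing.
Qed.

End cells.

Lemma trans_map (G H : cosimp_groupoid) (f : cg_map G H) n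
    (phi : cs_hom cosimp_simplex (cosimp_nerve G) n) l (u v : 'I_l.+1 * 'I_n.+1) :
  trans (cs_hom_map cosimp_simplex (cosimp_nerve_map f) n phi) u v =
  amap (f l) (trans phi u v).
Proof.
have e (w : 'I_l.+1 * 'I_n.+1) :
    cell_edge (cs_hom_map cosimp_simplex (cosimp_nerve_map f) n phi) w =
    amap (f l) (cell_edge phi w) by exact: carr_map.
rewrite /trans !e amap_comp ?amap_inv ?tgt_ainv//; exact: src_cell_edge.
Qed.

Local Notation totspace G := (cs_hom cosimp_simplex (cosimp_nerve G)).
Local Notation tot_map f := (cs_hom_map cosimp_simplex (cosimp_nerve_map f)).

Section cosimplicial_arrows.
Context (G H : cosimp_groupoid) (f : cg_map G H).

Lemma cg_fun_ob m n (c : omap m n) (x : G m) :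
  f n (cg_act G c x) = cg_act H c (f m x).
Proof. exact: (congr1 (fun F : gfunctor _ _ => F x) (cg_fun_nat f c)). Qed.

Lemma cg_fun_amap m n (c : omap m n) (a : arrow (G m)) :
  amap (f n) (amap (cg_act G c) a) = amap (cg_act H c) (amap (f m) a).
Proof. exact: (congr1 (fun F => amap F a) (cg_fun_nat f c)). Qed.

Lemma cg_act_vertex m n (c : omap m n) (i : 'I_m.+1) (x : G 0%N) :
  cg_act G c (cg_act G (vertex_omap i) x) = cg_act G (vertex_omap (c i)) x.
Proof.
by rewrite -comp_vertex_omap cg_act_comp.
Qed.

Lemma amap_vertex m n (c : omap m n) (i : 'I_m.+1) (a : arrow (G 0%N)) :
  amap (cg_act G c) (amap (cg_act G (vertex_omap i)) a) =
  amap (cg_act G (vertex_omap (c i))) a.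
Proof. by rewrite -comp_vertex_omap cg_act_comp. Qed.

Lemma tob_vertex n (phi : totspace G n) l (i : 'I_l.+1) (j : 'I_n.+1) :
  cg_act G (vertex_omap i) (tob phi (ord0 : 'I_1, j)) = tob phi (i, j).
Proof.
by rewrite -(src_trans phi (ord0 : 'I_1, j) (ord0 : 'I_1, j)) -src_amap trans_cs_act src_trans.
Qed.

End cosimplicial_arrows.

(** * Rebasing simplices along isomorphisms in degree 0 *)

Section rebase.
Context (G H : cosimp_groupoid) (f : cg_map G H).
Hypotheses (full_f : forall l, full (f l)) (faithful_f : forall l, faithful (f l)).

(* The matrix over [f] that a rebasing of [phi] along the isomorphisms [kappa]
   must have; [b] need not be monotone. *)
Definition rebase_arrow n n' (phi : totspace H n) (b : 'I_n'.+1 -> 'I_n.+1)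
    (kappa : 'I_n'.+1 -> arrow (H 0%N)) l (u v : 'I_l.+1 * 'I_n'.+1) :=
  acomp (ainv (amap (cg_act H (vertex_omap v.1)) (kappa v.2)))
    (acomp (trans phi (u.1, b u.2) (v.1, b v.2))
       (amap (cg_act H (vertex_omap u.1)) (kappa u.2))).

(** Sources are prescribed because a faithful functor separates only arrows with equal ends; targets
    follow from the entries with [u = v]. *)
Definition is_rebase n n' (phi : totspace H n) (b : 'I_n'.+1 -> 'I_n.+1)
    (x : 'I_n'.+1 -> G 0%N) (kappa : 'I_n'.+1 -> arrow (H 0%N))
    (psi : totspace G n') : Prop :=
  forall l (u v : 'I_l.+1 * 'I_n'.+1),
    src (trans psi u v) = cg_act G (vertex_omap u.1) (x u.2) /\
    amap (f l) (trans psi u v) = rebase_arrow phi b kappa u v.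

(** Simpliciality, the ends of the homotopies and the triangle identity all come down to this: both
    sides rebase the same data. *)
Lemma rebase_uniq n n' (phi : totspace H n) b x kappa (psi psi' : totspace G n') :
  is_rebase phi b x kappa psi -> is_rebase phi b x kappa psi' -> psi = psi'.
Proof.
move=> h h'; apply: trans_ext => l u v.
have [s e] := h l u v; have [s' e'] := h' l u v.
apply: (faithful_arrow (@faithful_f l)); rewrite ?s ?s' ?e ?e'//.
rewrite !tgt_trans -(src_trans _ v v) -(src_trans _ v v).
by rewrite (h l v v).1 (h' l v v).1.
Qed.

(** Two operators occur since [psi] may have the vertices of a join while [phi] has those of [n], as
    with [joinl] over the identity. *)
Lemma rebase_sact m n m' n' (a : omap m n) (a' : omap m' n') (phi : totspace H n)
    b b' x kappa (psi : totspace G n') :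
  (forall j, b (a' j) = a (b' j)) ->
  is_rebase phi b x kappa psi ->
  is_rebase (sact a phi) b' (fun j => x (a' j)) (fun j => kappa (a' j)) (sact a' psi).
Proof.
move=> ba h l u v; have [s e] := h l (u.1, a' u.2) (v.1, a' v.2).
by rewrite /rebase_arrow !trans_sact s e /rebase_arrow /= !ba.
Qed.

(** The conjugated matrix has its objects in the image of [f], so fullness lifts the entries, and
    faithfulness lifts functoriality and naturality. *)
Lemma rebase_ex n n' (phi : totspace H n) b x kappa :
  (forall j, src (kappa j) = f 0%N (x j)) ->
  (forall j, tgt (kappa j) = tob phi (ord0 : 'I_1, b j)) ->
  exists psi : totspace G n', is_rebase phi b x kappa psi.
Proof.
move=> ks kt.
pose k l (u : 'I_l.+1 * 'I_n'.+1) := amap (cg_act H (vertex_omap u.1)) (kappa u.2).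
pose ob l (u : 'I_l.+1 * 'I_n'.+1) := cg_act G (vertex_omap u.1) (x u.2).
pose B l u v := rebase_arrow phi b kappa (u : 'I_l.+1 * 'I_n'.+1) v.
have ksrc l u : src (k l u) = f l (ob l u) by rewrite src_amap ks cg_fun_ob.
have ktgt l u : tgt (k l u) = tob phi (u.1, b u.2) by rewrite tgt_amap kt tob_vertex.
have BE l u v : B l u v = acomp (ainv (k l v))
    (acomp (trans phi (u.1, b u.2) (v.1, b v.2)) (k l u)) by [].
have c1 l u v : tgt (k l u) = src (trans phi (u.1, b u.2) (v.1, b v.2)).
  by rewrite src_trans.
have c2 l u v : tgt (acomp (trans phi (u.1, b u.2) (v.1, b v.2)) (k l u)) = tgt (k l v).
  by rewrite tgt_acomp// tgt_trans.
have Bs l u v : src (B l u v) = f l (ob l u) by rewrite BE !src_acomp.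
have Bt l u v : tgt (B l u v) = f l (ob l v) by rewrite BE tgt_acomp// tgt_ainv.
have BI l u : B l u u = aid (f l (ob l u)).
  by rewrite BE trans_id acomp_idl// acompVl ksrc.
have BC l u v w : acomp (B l v w) (B l u v) = B l u w.
  rewrite {1}BE -acompA.
  - rewrite -acompA; [|by rewrite Bt ksrc|by []].
    rewrite (BE l u v) acompVKl; last exact: c2.
    by rewrite (@acompA _ (trans _ _ _) (trans _ _ _)); [rewrite trans_comp|exact: c1|rewrite tgt_trans src_trans].
  - by rewrite Bt src_acomp ksrc.
  - by rewrite c2 src_ainv.
(* The isomorphisms at level [l] are images of [kappa] under vertex maps, so [c] carries them
   strictly to those at level [l']. *)
have Bn l l' (c : omap l l') u v :
    amap (cg_act H c) (B l u v) = B l' (c u.1, u.2) (c v.1, v.2).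
  rewrite !BE amap_comp; last by rewrite c2.
  rewrite amap_comp// amap_inv trans_cs_act.
  by rewrite /k !amap_vertex.
have lift l (uv : ('I_l.+1 * 'I_n'.+1) * ('I_l.+1 * 'I_n'.+1)) : exists a : arrow (G l),
    [/\ src a = ob l uv.1, tgt a = ob l uv.2 & amap (f l) a = B l uv.1 uv.2].
  by apply: (full_arrow (@full_f l)).
pose A l u v := projT1 (cid (lift l (u, v))).
have AP l u v : [/\ src (A l u v) = ob l u, tgt (A l u v) = ob l v &
    amap (f l) (A l u v) = B l u v] := projT2 (cid (lift l (u, v))).
have As l u v : src (A l u v) = ob l u by case: (AP l u v).
have At l u v : tgt (A l u v) = ob l v by case: (AP l u v).
have Af l u v : amap (f l) (A l u v) = B l u v by case: (AP l u v).
have [psi hpsi] : exists psi : totspace G n', forall l u v, trans psi u v = A l u v.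
  apply: (trans_build (ob := ob)) => //.
  - move=> l u; apply: (faithful_arrow (@faithful_f l)); rewrite ?As ?At//.
    by rewrite Af amap_id BI.
  - move=> l u v w; apply: (faithful_arrow (@faithful_f l)).
    + by rewrite src_acomp !As.
    + by rewrite tgt_acomp !At ?As.
    + by rewrite amap_comp ?At ?As// !Af BC.
  - move=> l l' c u v; apply: (faithful_arrow (@faithful_f l')).
    + by rewrite src_amap !As /ob cg_act_vertex.
    + by rewrite tgt_amap !At /ob cg_act_vertex.
    + by rewrite cg_fun_amap !Af Bn.
by exists psi => l u v; rewrite hpsi As Af.
Qed.

End rebase.

(** * Joins and the homotopy inverse *)

Definition join_fun n (T : Type) (x y : 'I_n.+1 -> T) (p : 'I_(n.+1 + n.+1)) : T :=
  match fintype.split p with inl i => x i | inr j => y j end.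

Lemma join_funl n T (x y : 'I_n.+1 -> T) i : join_fun x y (lshift n.+1 i) = x i.
Proof. by rewrite /join_fun (unsplitK (inl i)). Qed.

Lemma join_funr n T (x y : 'I_n.+1 -> T) i : join_fun x y (rshift n.+1 i) = y i.
Proof. by rewrite /join_fun (unsplitK (inr i)). Qed.

Lemma joinP n (P : 'I_(n.+1 + n.+1) -> Prop) :
  (forall i, P (lshift n.+1 i)) -> (forall i, P (rshift n.+1 i)) -> forall p, P p.
Proof. by move=> Pl Pr p; rewrite -(splitK p); case: (fintype.split p). Qed.

Definition join_omap_fun m n (a : omap m n) : 'I_(m.+1 + m.+1) -> 'I_(n.+1 + n.+1) :=
  join_fun (fun i => lshift n.+1 (a i)) (fun i => rshift n.+1 (a i)).

Lemma join_omap_le m n (a : omap m n) (i j : 'I_(m.+1 + m.+1)) :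
  (i <= j)%N -> (join_omap_fun a i <= join_omap_fun a j)%N.
Proof.
rewrite /join_omap_fun; elim/joinP: i => i; elim/joinP: j => j; rewrite ?join_funl ?join_funr/=.
- exact: omap_le.
- by move=> _; apply: leq_trans (leq_addr _ _); exact/ltnW.
- by move=> /(leq_trans (leq_addr i m.+1)); rewrite leqNgt ltn_ord.
- by rewrite !leq_add2l; exact: omap_le.
Qed.

Definition join_omap m n (a : omap m n) : omap (m + m.+1) (n + n.+1) :=
  @Omap (m + m.+1) (n + n.+1) (join_omap_fun a) (@join_omap_le m n a).

Lemma joinl_le n (i j : 'I_n.+1) : (i <= j)%N -> (lshift n.+1 i <= lshift n.+1 j)%N.
Proof. by []. Qed.

Lemma joinr_le n (i j : 'I_n.+1) : (i <= j)%N -> (rshift n.+1 i <= rshift n.+1 j)%N.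
Proof. by rewrite /= leq_add2l. Qed.

Definition joinl n : omap n (n + n.+1) := @Omap n (n + n.+1) _ (@joinl_le n).
Definition joinr n : omap n (n + n.+1) := @Omap n (n + n.+1) _ (@joinr_le n).

(* A homotopy between simplicial maps in which the homotopy from [phi0 x] to
   [phi1 x] runs linearly through a simplex [J x] on the join of two copies
   of [n], rather than through the prism on [n]. *)
Definition join_homotopy (X Y : sset) (phi0 phi1 : smap X Y)
    (J : forall n, X n -> Y (n + n.+1)%N) : Prop :=
  [/\ forall m n (a : omap m n) (x : X n), J m (sact a x) = sact (join_omap a) (J n x),
      forall n (x : X n), sact (joinl n) (J n x) = phi0 n x &
      forall n (x : X n), sact (joinr n) (J n x) = phi1 n x].

Lemma id_cg_map_nat (G : cosimp_groupoid) m n (a : omap m n) :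
  comp_gfunctor (id_gfunctor (G n)) (cg_act G a) =
  comp_gfunctor (cg_act G a) (id_gfunctor (G m)).
Proof.
by rewrite /comp_gfunctor /=; congr Gfunctor; exact: Prop_irrelevance.
Qed.

(** Rebasing within [H] is rebasing over this map. *)
Definition id_cg_map (G : cosimp_groupoid) : cg_map G G :=
  @CgMap G G (fun n => id_gfunctor (G n)) (@id_cg_map_nat G).

Lemma rebase_eq (G H : cosimp_groupoid) (f : cg_map G H) n n' (phi : totspace H n)
    b b' x x' kappa kappa' (psi : totspace G n') :
  b =1 b' -> x =1 x' -> kappa =1 kappa' ->
  is_rebase f phi b x kappa psi -> is_rebase f phi b' x' kappa' psi.
Proof. by move=> /funext -> /funext -> /funext ->. Qed.

Lemma rebase_id (G H : cosimp_groupoid) (f : cg_map G H) n (phi : totspace G n) :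
  is_rebase f (tot_map f n phi) id (fun j => tob phi (ord0 : 'I_1, j))
    (fun j => aid (f 0%N (tob phi (ord0 : 'I_1, j)))) phi.
Proof.
move=> l [i j] [i' j']; rewrite src_trans tob_vertex; split => //.
rewrite /rebase_arrow trans_map /= !amap_id ainv_id -!cg_fun_ob !tob_vertex.
have s : src (amap (f l) (trans phi (i, j) (i', j'))) = f l (tob phi (i, j)).
  by rewrite src_amap src_trans.
have t : tgt (amap (f l) (trans phi (i, j) (i', j'))) = f l (tob phi (i', j')).
  by rewrite tgt_amap tgt_trans.
by rewrite acomp_idr// acomp_idl.
Qed.

Lemma rebase_map (G H : cosimp_groupoid) (f : cg_map G H) n n' (phi : totspace H n)
    b x kappa (psi : totspace G n') :
  is_rebase f phi b x kappa psi ->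
  is_rebase (id_cg_map H) phi b (fun j => f 0%N (x j)) kappa (tot_map f n' psi).
Proof.
move=> h l u v; have [s e] := h l u v.
by rewrite trans_map amap_id_gfunctor src_amap s cg_fun_ob e.
Qed.

Lemma tob_map (G H : cosimp_groupoid) (f : cg_map G H) n (phi : totspace G n)
    l (u : 'I_l.+1 * 'I_n.+1) :
  tob (tot_map f n phi) u = f l (tob phi u).
Proof. by rewrite -(src_trans _ _ u) trans_map src_amap src_trans. Qed.

Lemma tob_sact (G : cosimp_groupoid) m n (a : omap m n) (phi : totspace G n)
    l (u : 'I_l.+1 * 'I_m.+1) :
  tob (sact a phi) u = tob phi (u.1, a u.2).
Proof. by rewrite -(src_trans _ _ u) trans_sact src_trans. Qed.

Section totspace_equivalence.
Context (G H : cosimp_groupoid) (f : cg_map G H).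
Hypotheses (full_f : forall l, full (f l)) (faithful_f : forall l, faithful (f l)).
Hypothesis (surj_f : essentially_surjective (f 0%N)).

Lemma tot_homotopy_inverse : exists (g : smap (totspace H) (totspace G))
  (J : forall n, totspace G n -> totspace G (n + n.+1)%N)
  (K : forall n, totspace H n -> totspace H (n + n.+1)%N),
  [/\ join_homotopy (comp_smap g (tot_map f)) (id_smap _) J,
      join_homotopy (comp_smap (tot_map f) g) (id_smap _) K &
      forall n (phi : totspace G n), tot_map f _ (J n phi) = K n (tot_map f _ phi)].
Proof.
have full_i l : full (id_cg_map H l) by move=> x y h; exists h.
have faithful_i l : faithful (id_cg_map H l) by [].
(* The choice depends on the object alone, so the inverse built from it commutes with the simplicial
   operators. *)
have /choice [rk rkP] (y : H 0%N) : exists p : G 0%N * arrow (H 0%N),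
    src p.2 = f 0%N p.1 /\ tgt p.2 = y.
  by have [x [h]] := surj_f y; exists (x, arr h).
pose r y := (rk y).1; pose k y := (rk y).2.
have ks y : src (k y) = f 0%N (r y) := (rkP y).1.
have kt y : tgt (k y) = y := (rkP y).2.
pose o (K : cosimp_groupoid) n (phi : totspace K n) j := tob phi (ord0 : 'I_1, j).
have oE (K : cosimp_groupoid) n (phi : totspace K n) j : tob phi (ord0 : 'I_1, j) = o K n phi j by [].
have oa (K : cosimp_groupoid) m n (a : omap m n) (phi : totspace K n) j :
    o K m (sact a phi) j = o K n phi (a j) by rewrite /o tob_sact.
have of_ n (phi : totspace G n) j : o H n (tot_map f n phi) j = f 0%N (o G n phi j).
  exact: tob_map.
have gex n (phi : totspace H n) : exists psi : totspace G n,
    is_rebase f phi id (fun j => r (o H n phi j)) (fun j => k (o H n phi j)) psi.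
  by apply: rebase_ex => // j; rewrite kt.
pose g0 n phi := projT1 (cid (gex n phi)).
have g0P n phi := projT2 (cid (gex n phi)) : is_rebase f phi id _ _ (g0 n phi).
have g1 m n (a : omap m n) (phi : totspace H n) : g0 m (sact a phi) = sact a (g0 n phi).
  apply: (rebase_uniq faithful_f (g0P m (sact a phi))).
  by apply: rebase_eq (rebase_sact (b' := id) _ (g0P n phi)) => // j; rewrite oa.
(* The vertices of [f phi] are doubled: over the first copy lie the chosen objects, over the second
   those of [phi] itself. *)
have Jex n (phi : totspace G n) : exists psi : totspace G (n + n.+1)%N,
    is_rebase f (tot_map f n phi) (join_fun id id)
      (join_fun (fun j => r (f 0%N (o G n phi j))) (o G n phi))
      (join_fun (fun j => k (f 0%N (o G n phi j))) (fun j => aid (f 0%N (o G n phi j)))) psi.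
  by apply: rebase_ex => //; elim/joinP => j; rewrite ?join_funl ?join_funr ?kt ?oE ?of_.
have Kex n (phi : totspace H n) : exists psi : totspace H (n + n.+1)%N,
    is_rebase (id_cg_map H) phi (join_fun id id)
      (join_fun (fun j => f 0%N (r (o H n phi j))) (o H n phi))
      (join_fun (fun j => k (o H n phi j)) (fun j => aid (o H n phi j))) psi.
  by apply: rebase_ex => //; elim/joinP => j; rewrite ?join_funl ?join_funr ?kt ?oE.
pose J0 n phi := projT1 (cid (Jex n phi)).
have J0P n phi := projT2 (cid (Jex n phi)) : is_rebase f _ _ _ _ (J0 n phi).
pose K0 n phi := projT1 (cid (Kex n phi)).
have K0P n phi := projT2 (cid (Kex n phi)) : is_rebase _ _ _ _ _ (K0 n phi).
have uniqi n n' := @rebase_uniq _ _ (id_cg_map H) faithful_i n n'.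
have fold_join m n (a : omap m n) (j : 'I_(m + m.+1).+1) :
    join_fun id id (join_omap a j) = a (join_fun id id j).
  move: j; elim/joinP => j /=; rewrite /join_omap_fun.
    by rewrite !join_funl.
  by rewrite !join_funr.
exists (@Smap (totspace H) (totspace G) g0 g1), J0, K0; split.
- split=> [m n a phi|n phi|n phi].
  + apply: (rebase_uniq faithful_f (J0P m (sact a phi))).
    rewrite smap_nat.
    apply: rebase_eq (rebase_sact (fold_join _ _ a) (J0P n phi)) => //.
    * move=> j; move: j; elim/joinP => j /=; rewrite /join_omap_fun ?join_funl ?join_funr ?oa //.
    * move=> j; move: j; elim/joinP => j /=; rewrite /join_omap_fun ?join_funl ?join_funr ?oa //.
  + apply: (rebase_uniq faithful_f _ (g0P n (tot_map f n phi))).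
    have e (j : 'I_n.+1) : join_fun id id (joinl n j) = id_omap n (id j) by rewrite join_funl.
    rewrite -[X in is_rebase _ X](sact_id (tot_map f n phi)).
    apply: rebase_eq (rebase_sact e (J0P n phi)) => // j; rewrite /= join_funl ?of_//.
  + apply: (rebase_uniq faithful_f _ (rebase_id f phi)).
    have e (j : 'I_n.+1) : join_fun id id (joinr n j) = id_omap n (id j) by rewrite join_funr.
    rewrite -[X in is_rebase _ X](sact_id (tot_map f n phi)).
    apply: rebase_eq (rebase_sact e (J0P n phi)) => // j; rewrite /= join_funr//.
- split=> [m n a phi|n phi|n phi].
  + apply: (uniqi _ _ _ _ _ _ _ _ (K0P m (sact a phi))).
    apply: rebase_eq (rebase_sact (fold_join _ _ a) (K0P n phi)) => //.
    * move=> j; move: j; elim/joinP => j /=; rewrite /join_omap_fun ?join_funl ?join_funr ?oa //.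
    * move=> j; move: j; elim/joinP => j /=; rewrite /join_omap_fun ?join_funl ?join_funr ?oa //.
  + apply: (uniqi _ _ _ _ _ _ _ _ _ (rebase_map (g0P n phi))).
    have e (j : 'I_n.+1) : join_fun id id (joinl n j) = id_omap n (id j) by rewrite join_funl.
    rewrite -[X in is_rebase _ X](sact_id phi).
    apply: rebase_eq (rebase_sact e (K0P n phi)) => // j; rewrite /= join_funl//.
  + have hi := rebase_id (id_cg_map H) phi.
    have ei : tot_map (id_cg_map H) n phi = phi.
      by apply: trans_ext => l u v; rewrite trans_map amap_id_gfunctor.
    rewrite ei in hi.
    apply: (uniqi _ _ _ _ _ _ _ _ _ hi).
    have e (j : 'I_n.+1) : join_fun id id (joinr n j) = id_omap n (id j) by rewrite join_funr.
    rewrite -[X in is_rebase _ X](sact_id phi).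
    apply: rebase_eq (rebase_sact e (K0P n phi)) => // j; rewrite /= join_funr//.
(* Both simplices rebase [f phi] within [H] along the same isomorphisms. *)
- move=> n phi; apply: (uniqi _ _ _ _ _ _ _ _ _ (K0P n (tot_map f n phi))).
  apply: rebase_eq (rebase_map (J0P n phi)) => //;
    by move=> j; move: j; elim/joinP => j /=; rewrite ?join_funl ?join_funr ?of_.
Qed.

End totspace_equivalence.

(** * Geometric realization *)

Section realization_lemmas.
Context {R : realType}.
Local Notation simplex n := (set_type (@top_simplex R n)).

Lemma realization_pt_continuous (X : sset) n (x : X n) :
  continuous (realization_pt x : simplex n -> realization R X).
Proof.
move=> t; apply: (continuous_comp (f := cover_pt x)).
  exact: existT_continuous.
exact: pi_continuous.
Qed.

Lemma realizationP (X : sset) (P : realization R X -> Prop) :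
  (forall n (x : X n) (t : simplex n), P (realization_pt x t)) -> forall z, P z.
Proof.
move=> h z; pose z' : {eq_quot (realization_equiv R X)} := z.
have -> : z = \pi_({eq_quot (realization_equiv R X)}) (repr z') by rewrite reprK.
by case: (repr z') => [[n x] t]; exact: h.
Qed.

Lemma realization_open (X : sset) (U : set (realization R X)) :
  (forall n (x : X n), open ((realization_pt x : simplex n -> _) @^-1` U)) ->
  open U.
Proof. by move=> h; apply/sigT_openP => -[n x]; exact: h. Qed.

Lemma realization_continuous (X : sset) (T : topologicalType) (f : realization R X -> T) :
  (forall n (x : X n), continuous (fun t : simplex n => f (realization_pt x t))) ->
  continuous f.
Proof.
move=> h; apply/continuousP => A oA; apply: realization_open => n x.
by have /continuousP := h n x; exact.
Qed.

Lemma realization_pt_sact (X : sset) m n (a : omap m n) (x : X n) (t : simplex m) :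
  realization_pt (sact a x) t = realization_pt x (top_simplex_map a t).
Proof.
apply/(@eqquotP _ (realization_equiv R X)); apply/asboolP/rst_step.
exact: RealizationGlue.
Qed.

Lemma realization_rec (X : sset) (T : Type) (F : forall n, X n -> simplex n -> T) :
  (forall m n (a : omap m n) (x : X n) t, F m (sact a x) t = F n x (top_simplex_map a t)) ->
  exists f : realization R X -> T, forall n (x : X n) t, f (realization_pt x t) = F n x t.
Proof.
move=> Fg; pose F' (p : realization_cover R X) := F _ (projT2 (projT1 p)) (projT2 p).
exists (fun z => F' (repr (z : {eq_quot (realization_equiv R X)}))) => n x t.
have : realization_rel (repr (realization_pt x t : {eq_quot (realization_equiv R X)})) (cover_pt x t).
  exact/(@eqquotP _ (realization_equiv R X))/(reprK (_ : {eq_quot (realization_equiv R X)})).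
move=> /asboolP h; change (F' (repr (realization_pt x t : {eq_quot (realization_equiv R X)})) = F' (cover_pt x t)).
by elim: h => {n x t} [_ _ [m n a x t]|//|//|p q r _ -> _ ->//]; exact: Fg.
Qed.

Lemma realization_map_continuous (X Y : sset) (f : smap X Y) :
  continuous (@realization_map R X Y f).
Proof.
apply: realization_continuous => n x.
under eq_fun do rewrite realization_map_pt.
exact: realization_pt_continuous.
Qed.

Lemma realization_map_id (X : sset) (z : realization R X) : realization_map (id_smap X) z = z.
Proof. by elim/realizationP: z => n x t; rewrite realization_map_pt. Qed.

Lemma realization_map_comp (X Y Z : sset) (g : smap Y Z) (f : smap X Y) (z : realization R X) :
  realization_map (comp_smap g f) z = realization_map g (realization_map f z).
Proof. by elim/realizationP: z => n x t; rewrite !realization_map_pt. Qed.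

End realization_lemmas.

Lemma rV_continuous (R : realType) (T : topologicalType) n (f : T -> 'rV[R]_n) :
  (forall i, continuous (fun x => f x ord0 i)) -> continuous f.
Proof.
move=> h x A [P Px PA] /=.
have : \forall y \near x, forall i, P ord0 i (f y ord0 i).
  by apply: filter_forall => i; exact: (h i x _ (Px ord0 i)).
by apply: filterS => y hy; apply: PA => i j; rewrite (ord1 i).
Qed.

Lemma set_type_continuous (T U : topologicalType) (A : set U) (f : T -> A) :
  continuous (fun x => set_val (f x)) -> continuous f.
Proof. exact: continuous_comp_initial. Qed.

Section realization_prod.
Import ArrowAsCompactOpen.
Context {R : realType}.
Local Notation simplex n := (set_type (@top_simplex R n)).

(** The product of a quotient map with the locally compact Hausdorff space R is again a quotient
    map; the proof curries [h] into maps on R with the compact-open topology. *)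
Lemma realization_prod_continuous (X : sset) (T : topologicalType)
    (h : realization R X * R -> T) :
  (forall n (x : X n), continuous (fun p : simplex n * R => h (realization_pt x p.1, p.2))) ->
  continuous h.
Proof.
move=> hc.
have cc n (x : X n) := continuous_curry (hc n x).
have -> : h = uncurry (curry h) by apply: funext => -[].
apply: continuous_uncurry.
- exact: locally_compactR.
- exact: Rhausdorff.
- by apply: realization_continuous => n x; exact: (cc n x).1.
- by apply: realizationP => n x t; exact: (cc n x).2.
Qed.

End realization_prod.

(* The index types [(n + n.+1).+1] and [n.+1 + n.+1] are convertible, but not
   up to the unification done by [rewrite]. *)
Lemma join_eq_shift n (i j : 'I_n.+1) :
  (((lshift n.+1 i : 'I_(n + n.+1).+1) == lshift n.+1 j) = (i == j)) *
  (((rshift n.+1 i : 'I_(n + n.+1).+1) == rshift n.+1 j) = (i == j)) *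
  (((lshift n.+1 i : 'I_(n + n.+1).+1) == rshift n.+1 j) = false) *
  (((rshift n.+1 i : 'I_(n + n.+1).+1) == lshift n.+1 j) = false).
Proof.
by split; [split; [split|]|];
  [exact: eq_lshift|exact: eq_rshift|exact: (eq_lrshift i j)|exact: (eq_rlshift i j)].
Qed.

(** * Straight-line homotopies through joins *)

Section joins.
Context {R : realType}.
Local Notation simplex n := (set_type (@top_simplex R n)).

Lemma simplexP n (t : simplex n) : top_simplex (set_val t).
Proof. by have /set_mem := valP t. Qed.

Lemma simplex_ext n (t t' : simplex n) :
  (forall i, set_val t ord0 i = set_val t' ord0 i) -> t = t'.
Proof. by move=> e; apply: val_inj; apply/rowP => i; exact: e. Qed.

Lemma set_val_simplex_map m n (a : omap m n) (t : simplex m) j :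
  set_val (top_simplex_map a t) ord0 j = \sum_(i | a i == j) set_val t ord0 i.
Proof. by rewrite /= mxE. Qed.

(** A retraction onto [0, 1]: composing with it makes maps given on an interval or cube continuous
    on the whole space. *)
Definition clamp (u : R) : R := Num.max 0 (Num.min 1 u).

Lemma clamp01 u : 0 <= clamp u <= 1.
Proof. by rewrite /clamp le_max lexx ge_max ler01 ge_min lexx. Qed.

Lemma clamp_id u : 0 <= u <= 1 -> clamp u = u.
Proof. by move=> /andP[u0 u1]; rewrite /clamp (min_idPr u1) (max_idPr u0). Qed.

Lemma clamp_continuous : continuous clamp.
Proof.
move=> u; apply: (@continuous_max R R (fun=> 0) (Num.min 1)); first exact: cvg_cst.
by apply: (@continuous_min R R (fun=> 1) id); [exact: cvg_cst|exact: cvg_id].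
Qed.

Definition join_weights n (u : R) (t : 'rV[R]_n.+1) : 'rV[R]_(n.+1 + n.+1) :=
  row_mx ((1 - clamp u) *: t) (clamp u *: t).

Lemma join_weightsl n u (t : 'rV[R]_n.+1) i :
  join_weights u t ord0 (lshift n.+1 i) = (1 - clamp u) * t ord0 i.
Proof. by rewrite row_mxEl mxE. Qed.

Lemma join_weightsr n u (t : 'rV[R]_n.+1) i :
  join_weights u t ord0 (rshift n.+1 i) = clamp u * t ord0 i.
Proof. by rewrite row_mxEr mxE. Qed.

Lemma join_weights_subproof n (u : R) (t : simplex n) :
  (join_weights u (set_val t) : 'rV_(n + n.+1).+1) \in @top_simplex R (n + n.+1).
Proof.
have [t0 t1] := simplexP t; have /andP[c0 c1] := clamp01 u.
apply/mem_set; split.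
  apply: (@joinP n) => i.
    have -> := join_weightsl u (set_val t) i.
    by rewrite mulr_ge0// subr_ge0.
  have -> := join_weightsr u (set_val t) i.
  by rewrite mulr_ge0.
rewrite (@big_split_ord _ _ _ n.+1 n.+1)/=.
under eq_bigr => i _ do have -> := join_weightsl u (set_val t) i.
under [X in _ + X]eq_bigr => i _ do have -> := join_weightsr u (set_val t) i.
by rewrite -!mulr_sumr t1 !mulr1 subrK.
Qed.

Definition join_pt n (u : R) (t : simplex n) : simplex (n + n.+1) :=
  exist (fun v => v \in @top_simplex R (n + n.+1)) _ (join_weights_subproof u t).

Lemma set_val_join_ptl n u (t : simplex n) (i : 'I_n.+1) :
  set_val (join_pt u t) ord0 (lshift n.+1 i) = (1 - clamp u) * set_val t ord0 i.
Proof. exact: join_weightsl. Qed.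

Lemma set_val_join_ptr n u (t : simplex n) (i : 'I_n.+1) :
  set_val (join_pt u t) ord0 (rshift n.+1 i) = clamp u * set_val t ord0 i.
Proof. exact: join_weightsr. Qed.

Lemma join_pt_map m n (a : omap m n) u (t : simplex m) :
  top_simplex_map (join_omap a) (join_pt u t) = join_pt u (top_simplex_map a t).
Proof.
apply: simplex_ext; apply: (@joinP n) => j.
  rewrite set_val_join_ptl !set_val_simplex_map (@big_split_ord _ _ _ m.+1 m.+1)/=.
  rewrite [X in _ + X]big1 ?addr0 => [|i]; last first.
    by rewrite /join_omap_fun join_funr join_eq_shift.
  rewrite mulr_sumr; apply: eq_big => i; last by rewrite -set_val_join_ptl.
  by rewrite /join_omap_fun join_funl join_eq_shift.
rewrite set_val_join_ptr !set_val_simplex_map (@big_split_ord _ _ _ m.+1 m.+1)/=.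
rewrite [X in X + _]big1 ?add0r => [|i]; last first.
  by rewrite /join_omap_fun join_funl join_eq_shift.
rewrite mulr_sumr; apply: eq_big => i; last by rewrite -set_val_join_ptr.
by rewrite /join_omap_fun join_funr join_eq_shift.
Qed.

Lemma join_pt0 n (t : simplex n) : join_pt 0 t = top_simplex_map (joinl n) t.
Proof.
apply: simplex_ext; apply: (@joinP n) => j; rewrite set_val_simplex_map/=.
  rewrite set_val_join_ptl clamp_id ?lexx ?ler01// subr0 mul1r.
  by rewrite (big_pred1 j)// => i; rewrite join_eq_shift.
rewrite set_val_join_ptr clamp_id ?lexx ?ler01// mul0r.
by rewrite big_pred0// => i; rewrite join_eq_shift.
Qed.

Lemma join_pt1 n (t : simplex n) : join_pt 1 t = top_simplex_map (joinr n) t.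
Proof.
apply: simplex_ext; apply: (@joinP n) => j; rewrite set_val_simplex_map/=.
  rewrite set_val_join_ptl clamp_id ?lexx ?ler01// subrr mul0r.
  by rewrite big_pred0// => i; rewrite join_eq_shift.
rewrite set_val_join_ptr clamp_id ?lexx ?ler01// mul1r.
by rewrite (big_pred1 j)// => i; rewrite join_eq_shift.
Qed.

Lemma simplex_coord_continuous n (i : 'I_n.+1) :
  continuous (fun t : simplex n => set_val t ord0 i).
Proof.
move=> t; apply: (@continuous_comp _ _ _ set_val (fun v : 'rV[R]_n.+1 => v ord0 i)).
  exact: initial_continuous.
exact: coord_continuous.
Qed.

Lemma join_pt_continuous n : continuous (fun p : simplex n * R => join_pt p.2 p.1).
Proof.
apply: set_type_continuous.
apply: (@rV_continuous R _ (n + n.+1).+1); apply: (@joinP n) => i.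
- under eq_fun do rewrite set_val_join_ptl.
  move=> p; apply: (@continuousM R _ (fun p : simplex n * R => 1 - clamp p.2)
     (fun p : simplex n * R => set_val p.1 ord0 i)).
    apply: continuousB; first exact: cvg_cst.
    apply: (@continuous_comp _ _ _ snd clamp); [exact: cvg_snd|exact: clamp_continuous].
  apply: (@continuous_comp _ _ _ fst (fun t : simplex n => set_val t ord0 i)).
    exact: cvg_fst.
  exact: simplex_coord_continuous.
- under eq_fun do rewrite set_val_join_ptr.
  move=> p; apply: (@continuousM R _ (fun p : simplex n * R => clamp p.2)
     (fun p : simplex n * R => set_val p.1 ord0 i)).
    apply: (@continuous_comp _ _ _ snd clamp); [exact: cvg_snd|exact: clamp_continuous].
  apply: (@continuous_comp _ _ _ fst (fun t : simplex n => set_val t ord0 i)).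
    exact: cvg_fst.
  exact: simplex_coord_continuous.
Qed.

(** The formula on points is recorded besides continuity because the triangle identity between two
    homotopies is checked on it. *)
Definition realized_homotopy (X Y : sset) (J : forall n, X n -> Y (n + n.+1)%N)
    (h : realization R X * R -> realization R Y) :=
  continuous h /\ forall n (x : X n) t u,
    h (realization_pt x t, u) = realization_pt (J n x) (join_pt u t).

Lemma join_homotopy_realization (X Y : sset) (phi0 phi1 : smap X Y) J :
  join_homotopy phi0 phi1 J -> exists h, [/\ realized_homotopy J h,
    forall z, h (z, 0) = realization_map phi0 z &
    forall z, h (z, 1) = realization_map phi1 z].
Proof.
move=> [Jn J0 J1].
have H u : exists h : realization R X -> realization R Y,
   forall n (x : X n) t, h (realization_pt x t) = realization_pt (J n x) (join_pt u t).
  apply: realization_rec => m n a x t.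
  by rewrite Jn realization_pt_sact join_pt_map.
have /choice [h hE] := H.
exists (fun p => h p.2 p.1); split.
- split=> [|n x t u]; last exact: hE.
  apply: realization_prod_continuous => n x /=.
  under eq_fun do rewrite hE.
  move=> p; apply: (continuous_comp (@join_pt_continuous n p)).
  exact: realization_pt_continuous.
- by apply: realizationP => n x t /=; rewrite hE join_pt0 -realization_pt_sact J0 realization_map_pt.
- by apply: realizationP => n x t /=; rewrite hE join_pt1 -realization_pt_sact J1 realization_map_pt.
Qed.

End joins.

Lemma pair_continuous (S T U : topologicalType) (f : S -> T) (g : S -> U) :
  continuous f -> continuous g -> continuous (fun s => (f s, g s)).
Proof. by move=> cf cg s; exact: (cvg_pair (cf s) (cg s)). Qed.

Lemma comp_continuous (S T U : topologicalType) (f : S -> T) (g : T -> U) :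
  continuous g -> continuous f -> continuous (fun s => g (f s)).
Proof. by move=> cg cf s; apply: (@continuous_comp _ _ _ f g); [exact: cf|exact: cg]. Qed.

(** * Spheroids and homotopy equivalences *)

Lemma id_continuous (T : topologicalType) : continuous (fun x : T => x).
Proof. by move=> x; exact: cvg_id. Qed.

Lemma fst_continuous (S T : topologicalType) : continuous (@fst S T).
Proof. by move=> p; exact: cvg_fst. Qed.

Lemma snd_continuous (S T : topologicalType) : continuous (@snd S T).
Proof. by move=> p; exact: cvg_snd. Qed.

Lemma within_retract_continuous (S S' T : topologicalType) (A : set S') (F : S' -> T)
    (r : S -> S') :
  {within A, continuous F} -> continuous r -> (forall s, A (r s)) ->
  continuous (F \o r).
Proof.
move=> cF cr Ar s U /= nU.
have : nbhs_subspace (r s : subspace A) (F @^-1` U) by exact: cF.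
rewrite -nbhs_subspace_in// => /(cr s) h.
have : nbhs s (r @^-1` [set x | A x -> (F @^-1` U) x]) by [].
by apply: filterS => s'; apply; exact: Ar.
Qed.

Lemma if_le_continuous (R : realType) (S T : topologicalType) (F1 F2 : S -> T)
    (rho : S -> R) (c : R) :
  continuous F1 -> continuous F2 -> continuous rho ->
  (forall s, rho s = c -> F1 s = F2 s) ->
  continuous (fun s => if rho s <= c then F1 s else F2 s).
Proof.
move=> c1 c2 cr e; apply/continuous_subspace_setT.
have -> : [set: S] = [set s | rho s <= c] `|` [set s | c <= rho s].
  by apply/esym/seteqP; split=> // s _; case: (leP (rho s) c) => h; [left|right; exact: ltW].
apply: withinU_continuous.
- exact: ((continuous_closedP rho).1 cr _ (@closed_le R c)).
- exact: ((continuous_closedP rho).1 cr _ (@closed_ge R c)).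
- apply: (@subspace_eq_continuous _ _ _ F1); last exact: continuous_subspaceT.
  by move=> s /set_mem /= h; rewrite /from_subspace h.
- apply: (@subspace_eq_continuous _ _ _ F2); last exact: continuous_subspaceT.
  move=> s /set_mem /= h; rewrite /from_subspace; case: ifPn => // h'.
  by rewrite e//; apply/eqP; rewrite eq_le h h'.
Qed.

Section spheroids.
Context {R : realType}.
Implicit Types (n : nat) (T : topologicalType).

Definition cube_clamp n (s : 'rV[R]_n) : 'rV[R]_n := map_mx clamp s.

Lemma cube_clamp_cube n (s : 'rV[R]_n) : cube n (cube_clamp s).
Proof. by move=> i; rewrite mxE clamp01. Qed.

Lemma cube_clamp_id n (s : 'rV[R]_n) : cube n s -> cube_clamp s = s.
Proof. by move=> h; apply/rowP => i; rewrite mxE clamp_id. Qed.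

Lemma cube_clamp_continuous n : continuous (@cube_clamp n).
Proof.
apply: rV_continuous => i; under eq_fun do rewrite mxE.
move=> s; apply: (@continuous_comp _ _ _ (fun s : 'rV[R]_n => s ord0 i) clamp).
  exact: coord_continuous.
exact: clamp_continuous.
Qed.

Lemma spheroid_continuous n T (x : T) (a : 'rV[R]_n -> T) :
  spheroid x a -> continuous (a \o @cube_clamp n).
Proof.
move=> [ca _]; apply: (within_retract_continuous ca).
  exact: cube_clamp_continuous.
exact: cube_clamp_cube.
Qed.

Lemma spheroidI n T (x : T) (a : 'rV[R]_n -> T) :
  continuous a -> (forall s, cube_boundary n s -> a s = x) -> spheroid x a.
Proof. by move=> ca ax; split=> //; exact: continuous_subspaceT. Qed.

Lemma spheroid_homotopicI n T (x : T) (a b : 'rV[R]_n -> T) (L : R * 'rV[R]_n -> T) :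
  continuous L ->
  (forall s, cube n s -> L (0, s) = a s) -> (forall s, cube n s -> L (1, s) = b s) ->
  (forall t s, 0 <= t <= 1 -> cube_boundary n s -> L (t, s) = x) ->
  spheroid_homotopic x a b.
Proof. by move=> cL L0 L1 Lx; exists L; split=> //; exact: continuous_subspaceT. Qed.

Lemma spheroid_homotopicE n T (x : T) (a b : 'rV[R]_n -> T) :
  spheroid_homotopic x a b -> exists L : R * 'rV[R]_n -> T,
  [/\ continuous L, forall s, cube n s -> L (0, s) = a s,
      forall s, cube n s -> L (1, s) = b s &
      forall t s, cube_boundary n s -> L (t, s) = x].
Proof.
move=> [L [cL L0 L1 Lx]]; exists (fun p => L (clamp p.1, cube_clamp p.2)); split.
- apply: (within_retract_continuous (r := fun p => (clamp p.1, cube_clamp p.2)) cL).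
    apply: pair_continuous.
      exact: (comp_continuous clamp_continuous (@fst_continuous _ _)).
    exact: (comp_continuous (@cube_clamp_continuous n) (@snd_continuous _ _)).
  by move=> p; split; [rewrite /= in_itv/= clamp01|exact: cube_clamp_cube].
- by move=> s cs /=; rewrite clamp_id ?lexx ?ler01// cube_clamp_id// L0.
- by move=> s cs /=; rewrite clamp_id ?lexx ?ler01// cube_clamp_id// L1.
- by move=> t s bs /=; rewrite cube_clamp_id ?Lx// ?clamp01//; case: bs.
Qed.

Lemma spheroid_homotopic_sym n T (x : T) (a b : 'rV[R]_n -> T) :
  spheroid_homotopic x a b -> spheroid_homotopic x b a.
Proof.
move=> /spheroid_homotopicE [L [cL L0 L1 Lx]].
apply: (spheroid_homotopicI (L := fun p => L (1 - p.1, p.2))).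
- apply: (comp_continuous cL); apply: pair_continuous; last exact: snd_continuous.
  by move=> p; apply: cvgB; [exact: cvg_cst|exact: cvg_fst].
- by move=> s cs /=; rewrite subr0 L1.
- by move=> s cs /=; rewrite subrr L0.
- by move=> t s _ bs /=; rewrite Lx.
Qed.

Lemma spheroid_homotopic_trans n T (x : T) (a b c : 'rV[R]_n -> T) :
  spheroid_homotopic x a b -> spheroid_homotopic x b c -> spheroid_homotopic x a c.
Proof.
move=> /spheroid_homotopicE [L [cL L0 L1 Lx]] /spheroid_homotopicE [M [cM M0 M1 Mx]].
(* The space coordinate is clamped because [L] at 1 and [M] at 0 agree only on the cube, while they
   are glued on the whole space. *)
pose h (d : R) (p : R * 'rV[R]_n) := (2 * p.1 - d, cube_clamp p.2).
have ch d : continuous (h d).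
  apply: pair_continuous.
    move=> p; apply: cvgB; last exact: cvg_cst.
    by apply: cvgM; [exact: cvg_cst|exact: cvg_fst].
  exact: (comp_continuous (@cube_clamp_continuous n) (@snd_continuous _ _)).
apply: (spheroid_homotopicI (L := fun p => if p.1 <= 2^-1 then L (h 0 p) else M (h 1 p))).
- apply: if_le_continuous.
  + exact: (comp_continuous cL (ch 0)).
  + exact: (comp_continuous cM (ch 1)).
  + exact: fst_continuous.
  + move=> [t s] /= ->; rewrite /h/= divff// subr0 subrr.
    by rewrite L1 ?M0//; exact: cube_clamp_cube.
- by move=> s cs /=; rewrite invr_ge0 ler0n /h/= mulr0 subr0 cube_clamp_id// L0.
- move=> s cs /=; rewrite leNgt invf_lt1// ltr1n/= /h/= mulr1 cube_clamp_id//.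
  by rewrite (_ : 2 - 1 = 1 :> R) ?M1//; lra.
- move=> t s _ bs /=; rewrite /h/= cube_clamp_id; last by case: bs.
  by rewrite Lx// Mx// if_same.
Qed.

Definition cube_center n : 'rV[R]_n := const_mx 2^-1.

(** The matrix norm is the sup norm, so the cube is the unit ball about its center and its boundary
    the unit sphere. *)
Definition cube_radius n (s : 'rV[R]_n) : R := `|2 *: (s - cube_center n)|.

(** With [mu] = 1/2 the half-size cube is blown up to the whole cube; with [mu] the radius of [s]
    this is the radial projection to the boundary. *)
Definition cube_dilate n (mu : R) (s : 'rV[R]_n) : 'rV[R]_n :=
  cube_clamp (cube_center n + mu^-1 *: (s - cube_center n)).

Lemma mulB_continuous (S : topologicalType) (f : S -> R) (c d : R) :
  continuous f -> continuous (fun s => c * (f s - d)).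
Proof.
move=> cf s; apply: cvgM; first exact: cvg_cst.
by apply: cvgB; [exact: cf|exact: cvg_cst].
Qed.

Lemma cube_radius_continuous n : continuous (@cube_radius n).
Proof.
have c : continuous (fun s : 'rV[R]_n => 2 *: (s - cube_center n)).
  apply: rV_continuous => i; under eq_fun do rewrite !mxE.
  by apply: mulB_continuous; exact: coord_continuous.
exact: (comp_continuous (@norm_continuous R 'rV[R]_n) c).
Qed.

Lemma cube_dilate_continuous n (S : topologicalType) (mu : S -> R) (s : S -> 'rV[R]_n) :
  continuous mu -> (forall p, mu p != 0) -> continuous s ->
  continuous (fun p => cube_dilate (mu p) (s p)).
Proof.
move=> cmu mu0 cs.
have c : continuous (fun p => cube_center n + (mu p)^-1 *: (s p - cube_center n)).
  apply: rV_continuous => i; under eq_fun do rewrite !mxE.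
  have ci : continuous (fun p => s p ord0 i).
    exact: (comp_continuous (@coord_continuous R 1 n ord0 i) cs).
  move=> p; apply: cvgD; first exact: cvg_cst.
  apply: cvgM; first by apply: cvgV => //; exact: cmu.
  by apply: cvgB; [exact: ci|exact: cvg_cst].
exact: (comp_continuous (@cube_clamp_continuous n) c).
Qed.

Lemma cube_dilate1 n (s : 'rV[R]_n) : cube n s -> cube_dilate 1 s = s.
Proof. by move=> cs; rewrite /cube_dilate invr1 scale1r addrC subrK cube_clamp_id. Qed.

Lemma coord_le_radius n (s : 'rV[R]_n) i : `|2 * (s ord0 i - 2^-1)| <= cube_radius s.
Proof.
rewrite /cube_radius /Num.Def.normr/= mx_normrE.
have -> : 2 * (s ord0 i - 2^-1) = (2 *: (s - cube_center n)) ord0 i by rewrite !mxE.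
exact: (le_bigmax _ (fun ij : 'I_1 * 'I_n => `|(2 *: (s - cube_center n)) ij.1 ij.2|) (ord0, i)).
Qed.

Lemma cube_radius_le1 n (s : 'rV[R]_n) : cube n s -> cube_radius s <= 1.
Proof.
move=> cs; rewrite /cube_radius /Num.Def.normr/= mx_normrE.
apply/bigmax_leP; split=> // -[j i] _ /=; rewrite !mxE (ord1 j).
have /andP[s0 s1] := cs i.
by rewrite ler_norml; apply/andP; split; lra.
Qed.

Lemma cube_radius_boundary n (s : 'rV[R]_n) : cube_boundary n s -> cube_radius s = 1.
Proof.
move=> [cs [i hi]]; apply/eqP; rewrite eq_le cube_radius_le1//=.
apply: le_trans (coord_le_radius s i).
case: hi => ->; first by rewrite sub0r mulrN divff// normrN normr1.
by rewrite (_ : 2 * (1 - 2^-1) = 1) ?normr1//; lra.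
Qed.

Lemma cube_dilate_boundary n (s : 'rV[R]_n) : 0 < cube_radius s ->
  cube_boundary n (cube_dilate (cube_radius s) s).
Proof.
move=> r0; split; first exact: cube_clamp_cube.
have : mx_norm (2 *: (s - cube_center n)) != 0 by rewrite gt_eqF.
(* A coordinate that attains the sup norm is the one pushed to 0 or 1. *)
move=> /mx_norm_neq0 [[j i] /=]; rewrite (ord1 j) => e.
exists i; rewrite /cube_dilate !mxE.
have {e}e : cube_radius s = `|2 * (s ord0 i - 2^-1)| by rewrite /cube_radius /Num.Def.normr/= e !mxE.
set d := s ord0 i - 2^-1 in e *.
have d0 : d != 0 by apply: contraTneq r0 => d0; rewrite e d0 mulr0 normr0 ltxx.
rewrite e normrM ger0_norm//.
case: (ltgtP d 0) => [dn|dp|/eqP]; last by rewrite (negbTE d0).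
- left; rewrite ltr0_norm//.
  have -> : (2 * - d)^-1 * d = - 2^-1 by field.
  by rewrite subrr clamp_id// lexx ler01.
- right; rewrite gtr0_norm//.
  have -> : (2 * d)^-1 * d = 2^-1 by field.
  by rewrite (_ : 2^-1 + 2^-1 = 1) ?clamp_id ?lexx ?ler01//; lra.
Qed.

End spheroids.

(** * Change of base point along a path *)

Section transport.
Context {R : realType} (T : topologicalType) (n : nat).
Implicit Types (a b : 'rV[R]_n -> T) (gamma : R -> T).

(* The collar around the half-size cube follows [gamma] along each ray. *)
Definition transport gamma a (s : 'rV[R]_n) : T :=
  if cube_radius s <= 2^-1 then a (cube_dilate 2^-1 s)
  else gamma (2 * cube_radius s - 1).

Lemma radius_path_continuous gamma (S : topologicalType) (s : S -> 'rV[R]_n) :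
  continuous gamma -> continuous s ->
  continuous (fun p => gamma (2 * cube_radius (s p) - 1)).
Proof.
move=> cg cs; apply: (comp_continuous cg) => p.
apply: cvgB; last exact: cvg_cst.
apply: cvgM; first exact: cvg_cst.
by apply: (@continuous_comp _ _ _ s (@cube_radius R n)); [exact: cs|exact: cube_radius_continuous].
Qed.

Lemma transport_homotopic gamma a b : continuous gamma ->
  spheroid_homotopic (gamma 0) a b ->
  spheroid_homotopic (gamma 1) (transport gamma a) (transport gamma b).
Proof.
move=> cg /spheroid_homotopicE [L [cL L0 L1 Lx]].
have h0 : 0 < 2^-1 :> R by rewrite invr_gt0.
apply: (spheroid_homotopicI (L := fun p => if cube_radius p.2 <= 2^-1
  then L (p.1, cube_dilate 2^-1 p.2) else gamma (2 * cube_radius p.2 - 1))).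
- apply: if_le_continuous.
  + apply: (comp_continuous cL); apply: pair_continuous; first exact: fst_continuous.
    apply: cube_dilate_continuous; last exact: snd_continuous.
      exact: cst_continuous.
    by move=> _; rewrite gt_eqF.
  + exact: (radius_path_continuous cg (@snd_continuous _ _)).
  + exact: (comp_continuous (@cube_radius_continuous R n) (@snd_continuous _ _)).
  + move=> [t s] /= e; rewrite e divff// subrr Lx// -e.
    by apply: cube_dilate_boundary; rewrite e.
- by move=> s cs /=; rewrite /transport L0//; exact: cube_clamp_cube.
- by move=> s cs /=; rewrite /transport L1//; exact: cube_clamp_cube.
- move=> t s _ bs /=; rewrite cube_radius_boundary// leNgt invf_lt1// ltr1n/= mulr1.
  by congr gamma; lra.
Qed.

Lemma transport_spheroid gamma a : continuous gamma -> spheroid (gamma 0) a ->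
  spheroid (gamma 1) (transport gamma a).
Proof.
move=> cg sa; have ca := spheroid_continuous sa.
have h0 : 0 < 2^-1 :> R by rewrite invr_gt0.
apply: spheroidI.
  have -> : transport gamma a = fun s => if cube_radius s <= 2^-1
      then (a \o @cube_clamp R n) (cube_dilate 2^-1 s) else gamma (2 * cube_radius s - 1).
    apply: funext => s; rewrite /transport/= [cube_clamp (cube_dilate _ _)]cube_clamp_id//.
    exact: cube_clamp_cube.
  apply: if_le_continuous.
  - apply: (comp_continuous ca).
    apply: cube_dilate_continuous; last exact: id_continuous.
      exact: cst_continuous.
    by move=> _; rewrite gt_eqF.
  - exact: (radius_path_continuous cg (@id_continuous _)).
  - exact: cube_radius_continuous.
  - move=> s e; rewrite e divff// subrr -e.
    have b := cube_dilate_boundary (_ : 0 < cube_radius s).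
    rewrite /= cube_clamp_id; last by apply: cube_clamp_cube.
    by apply: sa.2; apply: b; rewrite e.
move=> s bs; rewrite /transport cube_radius_boundary// leNgt invf_lt1// ltr1n/= mulr1.
by congr gamma; lra.
Qed.

(* The free homotopy [K] is squeezed into the inner cube of half-size
   [(1 + v) / 2], which fills the whole cube at [v = 1]. *)
Lemma transport_free_homotopy gamma a (K : 'rV[R]_n * R -> T) : continuous K ->
  (forall s, cube n s -> K (s, 0) = a s) ->
  (forall s u, cube_boundary n s -> K (s, u) = gamma u) ->
  spheroid_homotopic (gamma 1) (transport gamma a) (fun s => K (s, 1)).
Proof.
move=> cK K0 Kb.
(* In the inner cube [mu] is the size of that cube, so the time [2 * mu - 1] is [v]; in the collar
   it is the radius, so the dilation lands on the boundary, where [K] follows [gamma]. *)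
pose mu (p : R * 'rV[R]_n) : R := Num.max (cube_radius p.2) ((1 + clamp p.1) / 2).
have mu0 p : 0 < mu p.
  have /andP[c0 c1] := clamp01 p.1.
  by rewrite lt_max; apply/orP; right; lra.
have cmu : continuous mu.
  move=> p; apply: (@continuous_max R _ (fun p => cube_radius p.2) (fun p => (1 + clamp p.1) / 2)).
    exact: (comp_continuous (@cube_radius_continuous R n) (@snd_continuous _ _)).
  apply: cvgM; last exact: cvg_cst.
  apply: cvgD; first exact: cvg_cst.
  exact: (comp_continuous clamp_continuous (@fst_continuous _ _)).
apply: (spheroid_homotopicI (L := fun p => K (cube_dilate (mu p) p.2, 2 * mu p - 1))).
- apply: (comp_continuous cK); apply: pair_continuous.
    apply: cube_dilate_continuous => //; last exact: snd_continuous.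
    by move=> p; rewrite gt_eqF.
  move=> p; apply: cvgB; last exact: cvg_cst.
  by apply: cvgM; [exact: cvg_cst|exact: cmu].
- move=> s cs; rewrite /mu /transport /= clamp_id ?lexx ?ler01// addr0 mul1r.
  case: (leP (cube_radius s) 2^-1) => h.
    by rewrite divff// subrr K0//; exact: cube_clamp_cube.
  by rewrite Kb//; apply: cube_dilate_boundary; apply: le_lt_trans h; rewrite invr_ge0.
- move=> s cs; rewrite /mu /= clamp_id ?lexx ?ler01//.
  rewrite (_ : (1 + 1) / 2 = 1) ?(max_idPr (cube_radius_le1 cs))//; last by rewrite divff.
  by rewrite cube_dilate1// (_ : 2 * 1 - 1 = 1 :> R)//; lra.
- move=> t s t01 bs; rewrite /mu /= clamp_id// cube_radius_boundary//.
  have -> : Num.max 1 ((1 + t) / 2) = 1.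
    by apply/max_idPl; move/andP: t01 => [_ t1]; lra.
  rewrite cube_dilate1; last by case: bs.
  by rewrite Kb//; congr gamma; lra.
Qed.

End transport.

(** * Homotopy equivalences are weak equivalences *)

Section homotopy_equivalence.
Context {R : realType} (T U : topologicalType).

Lemma spheroid_comp (f : T -> U) n x (a : 'rV[R]_n -> T) : continuous f ->
  spheroid x a -> spheroid (f x) (f \o a).
Proof.
move=> cf [ca ax]; split=> [|s bs /=]; last by rewrite ax.
by move=> s; apply: (@continuous_comp (subspace (cube n)) T U a f); [exact: ca|exact: cf].
Qed.

Lemma spheroid_homotopic_comp (f : T -> U) n x (a b : 'rV[R]_n -> T) : continuous f ->
  spheroid_homotopic x a b -> spheroid_homotopic (f x) (f \o a) (f \o b).
Proof.
move=> cf /spheroid_homotopicE [L [cL L0 L1 Lx]].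
apply: (spheroid_homotopicI (L := f \o L)).
- exact: (comp_continuous cf cL).
- by move=> s cs /=; rewrite L0.
- by move=> s cs /=; rewrite L1.
- by move=> t s _ bs /=; rewrite Lx.
Qed.

Lemma path_joinedI (g : R -> T) : continuous g -> path_joined (R := R) (g 0) (g 1).
Proof. by move=> cg; exists g => //; exact: continuous_subspaceT. Qed.

Lemma path_joinedE (x y : T) : path_joined (R := R) x y ->
  exists g : R -> T, [/\ continuous g, g 0 = x & g 1 = y].
Proof.
move=> [g cg [g0 g1]]; exists (fun u => g (clamp u)); split.
- apply: (within_retract_continuous cg clamp_continuous) => u.
  by rewrite /= in_itv/= clamp01.
- by rewrite clamp_id ?lexx ?ler01.
- by rewrite clamp_id ?lexx ?ler01.
Qed.

Lemma path_joined_sym (x y : T) : path_joined (R := R) x y -> path_joined (R := R) y x.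
Proof.
move=> /path_joinedE [g [cg <- <-]].
have c : continuous (fun u : R => g (1 - u)).
  by apply: (comp_continuous cg) => u; apply: cvgB; [exact: cvg_cst|exact: cvg_id].
by have := path_joinedI c; rewrite subr0 subrr.
Qed.

Lemma path_joined_trans (x y z : T) : path_joined (R := R) x y ->
  path_joined (R := R) y z -> path_joined (R := R) x z.
Proof.
move=> /path_joinedE [g [cg <- g1]] /path_joinedE [h [ch h0 <-]].
have ca (d : R) : continuous (fun u : R => 2 * u - d).
  move=> u; apply: cvgB; last exact: cvg_cst.
  by apply: cvgM; [exact: cvg_cst|exact: cvg_id].
have c : continuous (fun u : R => if u <= 2^-1 then g (2 * u - 0) else h (2 * u - 1)).
  apply: (@if_le_continuous _ _ _ _ _ id).
  - exact: (comp_continuous cg (ca 0)).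
  - exact: (comp_continuous ch (ca 1)).
  - by move=> u; exact: cvg_id.
  - by move=> u /= ->; rewrite divff// subr0 subrr g1 h0.
have := path_joinedI c; rewrite mulr0 subr0 invr_ge0 ler0n.
by rewrite leNgt invf_lt1// ltr1n/= mulr1 (_ : 2 - 1 = 1 :> R)//; lra.
Qed.

End homotopy_equivalence.

(* The coherence [f (h (z, u)) = k (f z, u)] avoids the comparison of two
   different transports in the surjectivity on homotopy groups. *)
Lemma homotopy_equivalence_weq (R : realType) (T U : topologicalType) (f : T -> U)
    (g : U -> T) (h : T * R -> T) (k : U * R -> U) :
  continuous f -> continuous g -> continuous h -> continuous k ->
  (forall z, h (z, 0) = g (f z)) -> (forall z, h (z, 1) = z) ->
  (forall y, k (y, 0) = f (g y)) -> (forall y, k (y, 1) = y) ->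
  (forall z u, f (h (z, u)) = k (f z, u)) ->
  weak_homotopy_equivalence R f.
Proof.
move=> cf cg ch ck h0 h1 k0 k1 fh.
have cpath (V : topologicalType) (F : V * R -> V) (v : V) : continuous F -> continuous (fun u => F (v, u)).
  move=> cF; apply: (comp_continuous cF); apply: pair_continuous => u; first exact: cvg_cst.
  exact: cvg_id.
have hx x : path_joined (R := R) (g (f x)) x.
  by have := path_joinedI (cpath _ h x ch); rewrite h0 h1.
have ky y : path_joined (R := R) (f (g y)) y.
  by have := path_joinedI (cpath _ k y ck); rewrite k0 k1.
(* [F (a s, u)] is a free homotopy that ends at [a] and whose boundary runs along [F (v, u)]. *)
have free (V : topologicalType) n (F : V * R -> V) (v : V) (a : 'rV[R]_n -> V) :
    continuous F -> F (v, 1) = v -> (forall w, F (w, 1) = w) -> spheroid v a ->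
    spheroid_homotopic v (transport (fun u => F (v, u)) (fun s => F (a s, 0))) a.
  move=> cF F1 F1' sa; have ca := spheroid_continuous sa.
  have cK : continuous (fun p : 'rV[R]_n * R => F ((a \o @cube_clamp R n) p.1, p.2)).
    apply: (comp_continuous cF); apply: pair_continuous; last exact: snd_continuous.
    exact: (comp_continuous ca (@fst_continuous _ _)).
  have := @transport_free_homotopy R V n (fun u => F (v, u)) (fun s => F (a s, 0)) _ cK.
  rewrite F1 => H.
  apply: (spheroid_homotopic_trans (H _ _)).
  - by move=> s cs /=; rewrite cube_clamp_id.
  - by move=> s u bs /=; rewrite cube_clamp_id ?sa.2//; case: bs.
  - apply: (spheroid_homotopicI (L := fun p => (a \o @cube_clamp R n) p.2)).
    + exact: (comp_continuous ca (@snd_continuous _ _)).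
    + by move=> s cs /=; rewrite F1'.
    + by move=> s cs /=; rewrite cube_clamp_id.
    + by move=> t s _ bs /=; rewrite cube_clamp_id ?sa.2//; case: bs.
split.
- exact: cf.
- move=> x y /path_joinedE [p [cp p0 p1]].
  have := path_joinedI (comp_continuous cg cp); rewrite p0 p1 => q.
  apply: path_joined_trans (path_joined_trans q (hx y)).
  exact: path_joined_sym.
- by move=> y; exists (g y); exact: ky.
move=> n x _; split.
(* The homotopy is pushed forward by [g] and transported along [h (x, u)]; its two ends are
   homotopic to [a] and [b] by [free]. *)
- move=> a b sa sb ab.
  have := spheroid_homotopic_comp cg ab.
  rewrite -h0 => /(transport_homotopic (gamma := fun u => h (x, u)) (cpath _ h x ch)).
  rewrite h1 => q.
  have Ha := free _ n h x a ch (h1 x) h1 sa.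
  have Hb := free _ n h x b ch (h1 x) h1 sb.
  have e (c : 'rV[R]_n -> T) : (fun s => h (c s, 0)) = g \o (f \o c).
    by apply: funext => s; rewrite h0.
  rewrite e in Ha; rewrite e in Hb.
  exact: spheroid_homotopic_trans (spheroid_homotopic_sym Ha) (spheroid_homotopic_trans q Hb).
- move=> c sc; pose gamma u := h (x, u).
  have sg : spheroid (gamma 0) (g \o c) by rewrite /gamma h0; exact: spheroid_comp.
  exists (transport gamma (g \o c)).
    by have := transport_spheroid (cpath _ h x ch) sg; rewrite h1.
  have e : f \o transport gamma (g \o c) =
      transport (fun u => k (f x, u)) (fun s => k (c s, 0)).
    apply: funext => s; rewrite /transport /gamma /=.
    by case: ifP => _; rewrite ?k0 ?fh.
  rewrite e.
  exact: free.
Qed.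

Lemma realized_homotopy_equivalence (R : realType) (X Y : sset) (f : smap X Y)
    (g : smap Y X) (J : forall n, X n -> X (n + n.+1)%N) (K : forall n, Y n -> Y (n + n.+1)%N) :
  join_homotopy (comp_smap g f) (id_smap X) J ->
  join_homotopy (comp_smap f g) (id_smap Y) K ->
  (forall n (x : X n), f _ (J n x) = K n (f _ x)) ->
  weak_equivalence R f.
Proof.
move=> /(@join_homotopy_realization R) [h [[ch hE] h0 h1]].
move=> /(@join_homotopy_realization R) [k [[ck kE] k0 k1]] fJ.
apply: (@homotopy_equivalence_weq R _ _ _ (realization_map g) h k) => //.
- exact: realization_map_continuous.
- exact: realization_map_continuous.
- by move=> z; rewrite h0 realization_map_comp.
- by move=> z; rewrite h1 realization_map_id.
- by move=> z; rewrite k0 realization_map_comp.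
- by move=> z; rewrite k1 realization_map_id.
- move=> z u; move: z; apply: realizationP => n x t.
  by rewrite hE !realization_map_pt kE fJ.
Qed.

(** * Step functions and lifts *)

Section step_functions.
Context {R : realType}.
Local Notation simplex n := (set_type (@top_simplex R n)).

Definition psum n (t : 'rV[R]_n.+1) (i : nat) : R :=
  \sum_(k < n.+1 | (k < i)%N) t ord0 k.

(** Parameters outside [0, 1[ are sent to 0, so that [step] finds an interval for every real
    number. *)
Definition unit_arg (s : R) : R := if (0 <= s < 1) then s else 0.

Lemma unit_arg_id s : 0 <= s < 1 -> unit_arg s = s.
Proof. by rewrite /unit_arg => ->. Qed.

Lemma unit_arg_ge0 s : 0 <= unit_arg s.
Proof. by rewrite /unit_arg; case: ifP => // /andP[]. Qed.

Lemma unit_arg_lt1 s : unit_arg s < 1.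
Proof. by rewrite /unit_arg; case: ifP => // /andP[]. Qed.

Definition is_step n (t : 'rV[R]_n.+1) (s : R) (i : 'I_n.+1) : bool :=
  psum t i <= unit_arg s < psum t i.+1.

(* A point of the simplex is the step function on [0, 1[ that takes the value
   [i] on an interval of length [t_i]; a degeneracy or a face relabels the
   values and leaves the function unchanged. *)
Definition step n (t : 'rV[R]_n.+1) (s : R) : 'I_n.+1 :=
  odflt ord0 [pick i | is_step t s i].

Lemma simplex_sum_le n (t : simplex n) (P Q : pred 'I_n.+1) :
  (forall k, P k -> Q k) ->
  \sum_(k | P k) set_val t ord0 k <= \sum_(k | Q k) set_val t ord0 k.
Proof.
move=> PQ; have [t0 _] := simplexP t.
have <- : \sum_(k | Q k && P k) set_val t ord0 k = \sum_(k | P k) set_val t ord0 k.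
  by apply: eq_bigl => k; case: (boolP (P k)) => [/PQ ->|]; rewrite ?andbF.
by rewrite [leRHS](bigID P)/= lerDl sumr_ge0.
Qed.

Lemma psum_mono n (t : simplex n) i j : (i <= j)%N ->
  psum (set_val t) i <= psum (set_val t) j.
Proof. by move=> ij; apply: simplex_sum_le => k ki; exact: leq_trans ki ij. Qed.

Lemma is_step_uniq n (t : simplex n) s i j :
  is_step (set_val t) s i -> is_step (set_val t) s j -> i = j.
Proof.
move=> /andP[a b] /andP[c d]; apply/ord_inj/eqP; rewrite eqn_leq.
apply/andP; split; rewrite leqNgt; apply/negP => /(psum_mono t) h.
  by have := le_lt_trans (le_trans h a) d; rewrite ltxx.
by have := le_lt_trans (le_trans h c) b; rewrite ltxx.
Qed.

Lemma stepP n (t : simplex n) s : is_step (set_val t) s (step (set_val t) s).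
Proof.
rewrite /step; case: pickP => //= none; exfalso.
have s0 := unit_arg_ge0 s; have s1 := unit_arg_lt1 s; have [_ t1] := simplexP t.
have top : unit_arg s < psum (set_val t) n.+1.
  rewrite /psum (eq_bigl xpredT) ?t1// => k; exact: ltn_ord.
(* Otherwise the parameter lies beyond each partial sum in turn, including the last, which is 1. *)
have h m : (m <= n.+1)%N -> psum (set_val t) m <= unit_arg s.
  elim: m => [_|m IH mn]; first by rewrite /psum big_pred0.
  have := none (Ordinal mn); rewrite /is_step /= IH ?(ltnW mn)//= => /negbT.
  by rewrite -leNgt.
by have := h _ (leqnn _); rewrite leNgt top.
Qed.

Lemma step_eq n (t : simplex n) s i : is_step (set_val t) s i -> step (set_val t) s = i.
Proof. by apply: is_step_uniq; exact: stepP. Qed.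

(** As [a] is monotone, the indices sent below a given value form an initial segment, so the break
    points of the image are among those of [t]. *)
Lemma step_map m n (a : omap m n) (t : simplex m) s :
  step (set_val (top_simplex_map a t)) s = a (step (set_val t) s).
Proof.
apply: step_eq; have /andP[h1 h2] := stepP t s.
set i := step _ s in h1 h2 *.
have E j : psum (set_val (top_simplex_map a t)) j =
    \sum_(k < m.+1 | (a k < j)%N) set_val t ord0 k.
  rewrite /psum (partition_big a (fun l : 'I_n.+1 => (l < j)%N))//=.
  apply: eq_bigr => l lj; rewrite mxE; apply: eq_bigl => k.
  by case: eqP => [->|_]; rewrite ?lj ?andbF.
rewrite /is_step !E; apply/andP; split.
  apply: le_trans h1; apply: simplex_sum_le => k; apply: contraTT; rewrite -leqNgt -leqNgt.
  exact: omap_le.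
apply: lt_le_trans h2 _; apply: simplex_sum_le => k; rewrite !ltnS; exact: omap_le.
Qed.

(** A measurable set containing the disagreements is asked for, since for arbitrary functions their
    exact set need not be measurable. *)
Definition close (Z : Type) (e : R) (phi psi : R -> Z) : Prop :=
  exists A : set (measurableTypeR R), [/\ measurable A,
    (lebesgue_measure A <= e%:E)%E &
    forall s, 0 <= s < 1 -> ~ A s -> phi s = psi s].

Lemma close_refl Z e (phi : R -> Z) : 0 <= e -> close e phi phi.
Proof. by move=> e0; exists set0; split=> //; rewrite measure0 lee_fin. Qed.

Lemma close_sym Z e (phi psi : R -> Z) : close e phi psi -> close e psi phi.
Proof. by move=> [A [mA Ae h]]; exists A; split=> // s s01 As; rewrite h. Qed.

Lemma close_trans Z e e' (phi psi chi : R -> Z) :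
  close e phi psi -> close e' psi chi -> close (e + e') phi chi.
Proof.
move=> [A [mA Ae h]] [B [mB Be h']]; exists (A `|` B); split.
- exact: measurableU.
- apply: le_trans (measureU2 _ mA mB) _.
  by rewrite EFinD leeD.
- by move=> s s01 /not_orP[nA nB]; rewrite h// h'.
Qed.

Lemma closeW Z e e' (phi psi : R -> Z) : e <= e' -> close e phi psi -> close e' phi psi.
Proof.
move=> ee' [A [mA Ae h]]; exists A; split=> //.
by apply: le_trans Ae _; rewrite lee_fin.
Qed.

Lemma close_comp Z Z' e (phi psi : R -> Z) (f : Z -> Z') :
  close e phi psi -> close e (fun s => f (phi s)) (fun s => f (psi s)).
Proof. by move=> [A [mA Ae h]]; exists A; split=> // s s01 As; rewrite h. Qed.

Lemma close_meet Z e (phi psi : R -> Z) : e < 1 -> close e phi psi ->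
  exists s, phi s = psi s.
Proof.
move=> e1 [A [mA Ae h]]; apply: contrapT => /forallNP no.
have sub : `[0, 1[%classic `<=` A.
  move=> s; rewrite /= in_itv/= => s01; apply: contrapT => nA.
  exact: (no s (h _ s01 nA)).
have : (lebesgue_measure (`[0%R, 1%R[%classic : set R) <= e%:E)%E.
  apply: le_trans Ae; apply: le_measure; rewrite ?inE//.
by rewrite lebesgue_measure_itv/= lte_fin ltr01 -EFinB subr0 lee_fin leNgt e1.
Qed.

(** The steps differ only between the two positions of some break point. There are n + 2 partial
    sums, each moved by at most (n + 1) [eta]. *)
Lemma step_close n (t t' : simplex n) (eta : R) :
  (forall k, `|set_val t ord0 k - set_val t' ord0 k| <= eta) ->
  close ((n.+2 * n.+1)%:R * eta) (step (set_val t)) (step (set_val t')).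
Proof.
move=> h; pose lo i := Num.min (psum (set_val t) i) (psum (set_val t') i).
pose hi i := Num.max (psum (set_val t) i) (psum (set_val t') i).
pose I (i : nat) : set (measurableTypeR R) := `[lo i, hi i[%classic.
have mI i : measurable (I i) by exact: measurable_itv.
exists (\big[setU/set0]_(i < n.+2) I i); split.
- exact: bigsetU_measurable.
- apply: le_trans (Boole_inequality _ _) _ => //.
  apply: (@le_trans _ _ (\sum_(i < n.+2) ((n.+1%:R * eta)%:E))%E).
    apply: lee_sum => i _; rewrite -[leLHS]/(lebesgue_measure (`[lo i, hi i[%classic : set R)) lebesgue_measure_itv/=.
    have eta0 : 0 <= eta by apply: le_trans (h ord0).
    case: ifP => _; last by rewrite lee_fin mulr_ge0.
    rewrite -EFinB lee_fin.
    have -> : hi i - lo i = `|psum (set_val t) i - psum (set_val t') i|.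
      by rewrite /hi /lo maxr_absE minr_absE; field.
    rewrite /psum -sumrB; apply: le_trans (ler_norm_sum _ _ _) _.
    apply: (@le_trans _ _ (\sum_(k < n.+1) eta)).
      rewrite [leRHS](bigID (fun k : 'I_n.+1 => (k < i)%N))/=.
      by rewrite -[leLHS]addr0 lerD ?ler_sum// sumr_ge0.
    by rewrite sumr_const card_ord mulr_natl.
  by rewrite sumEFin sumr_const card_ord lee_fin natrM -mulrA [leRHS]mulr_natl.
- move=> s s01 nI.
  (* Off the exceptional intervals [s] lies on the same side of each break point for [t] and for
     [t']. *)
  have key i : (i < n.+2)%N -> (psum (set_val t) i <= unit_arg s) = (psum (set_val t') i <= unit_arg s).
    move=> ni; rewrite unit_arg_id//.
    have nIi : ~ I i s.
      move=> Is; apply: nI; rewrite -bigcup_mkord; exists i => //=.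
    apply/idP/idP => q; rewrite leNgt; apply/negP => q'; apply: nIi;
      by rewrite /I /lo /hi /= in_itv/= ge_min lt_max q q' ?orbT.
  apply/esym/step_eq; have /andP[a b] := stepP t s.
  set i := step _ s in a b *.
  by rewrite /is_step -(key _ (leqW (ltn_ord i))) a/= ltNge -(key i.+1 (ltn_ord i)) -ltNge.
Qed.

End step_functions.

(** * The covering of BG and the closeness of its fibres *)

Section lifts.
Context {R : realType} (G : groupoid).
Local Notation simplex n := (set_type (@top_simplex R n)).
Local Notation BG := (realization R (nerve G)).

(** By [step_map] the formula is invariant under gluing; a point thus becomes a functor on the
    indiscrete groupoid of parameters. *)
Lemma transition_ex : exists tr : BG -> R -> R -> arrow G,
  forall n (c : chain G n) (t : simplex n) s s',
    tr (realization_pt (c : nerve G n) t) s s' =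
    carr c (step (set_val t) s) (step (set_val t) s').
Proof.
have [|tr trE] := @realization_rec R (nerve G) (R -> R -> arrow G)
  (fun n c t s s' => carr c (step (set_val t) s) (step (set_val t) s')).
  by move=> m n a c t; apply: funext => s; apply: funext => s'; rewrite carr_act !step_map.
by exists tr => n c t s s'; rewrite trE.
Qed.

Definition transition : BG -> R -> R -> arrow G := projT1 (cid transition_ex).

Lemma transitionE n (c : chain G n) (t : simplex n) s s' :
  transition (realization_pt (c : nerve G n) t) s s' =
  carr c (step (set_val t) s) (step (set_val t) s').
Proof. exact: (projT2 (cid transition_ex)). Qed.

Definition pt_ob (w : BG) (s : R) : G := src (transition w s s).

Lemma src_transition w s s' : src (transition w s s') = pt_ob w s.
Proof.
by move: w; apply: realizationP => n c t; rewrite /pt_ob !transitionE !src_carr.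
Qed.

(* A point, over [w], of the covering of [BG] by the nerve of the arrows out of
   [x], recorded as its step function. *)
Definition is_lift (x : G) (w : BG) (la : R -> arrow G) : Prop :=
  [/\ forall s, src (la s) = x, forall s, tgt (la s) = pt_ob w s &
      forall s s', la s' = acomp (transition w s s') (la s)].

Lemma lift_eq x w la la' s : is_lift x w la -> is_lift x w la' -> la s = la' s -> la = la'.
Proof.
by move=> [_ _ h] [_ _ h'] e; apply: funext => s'; rewrite (h s) (h' s) e.
Qed.

Lemma lift_close_eq x w e la la' : e < 1 -> is_lift x w la -> is_lift x w la' ->
  close e la la' -> la = la'.
Proof. by move=> e1 l l' /(close_meet e1) [s es]; exact: lift_eq l l' es. Qed.

(** A simplex over [c] in the nerve of the arrows out of [x]. *)
Definition is_cone n (x : G) (c : chain G n) (m : 'I_n.+1 -> arrow G) : Prop :=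
  [/\ forall i, src (m i) = x, forall i, tgt (m i) = cob c i &
      forall i j, m j = acomp (carr c i j) (m i)].

Lemma cone_lift n x (c : chain G n) m (t : simplex n) : is_cone x c m ->
  is_lift x (realization_pt (c : nerve G n) t) (fun s => m (step (set_val t) s)).
Proof.
move=> [ms mt mc]; split=> // [s|s s']; last by rewrite transitionE -mc.
by rewrite mt /pt_ob transitionE src_carr.
Qed.

Lemma lift_cone n x (c : chain G n) (t : simplex n) la :
  is_lift x (realization_pt (c : nerve G n) t) la ->
  exists2 m, is_cone x c m & la = fun s => m (step (set_val t) s).
Proof.
(* Vertices of weight zero are not values of the step function, so the cone is propagated from the
   vertex at parameter 0. *)
move=> [ls lt lc]; pose i0 := step (set_val t) 0.
have l0 : tgt (la 0) = cob c i0 by rewrite lt /pt_ob transitionE src_carr.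
exists (fun i => acomp (carr c i0 i) (la 0)).
  split=> [i|i|i j]; first by rewrite src_acomp.
  - by rewrite tgt_acomp// l0.
  - by rewrite acompA ?carr_comp// l0.
by apply: funext => s; rewrite -transitionE -lc.
Qed.

(** A Hausdorff-distance bound between the fibres over [w] and [w']. *)
Definition near_pts (x : G) (e : R) (w w' : BG) : Prop :=
  (forall la, is_lift x w la -> exists2 la', is_lift x w' la' & close e la la') /\
  (forall la', is_lift x w' la' -> exists2 la, is_lift x w la & close e la la').

Lemma near_pts_sym x e w w' : near_pts x e w w' -> near_pts x e w' w.
Proof.
move=> [h1 h2]; split=> la l.
  by have [la' l' c] := h2 _ l; exists la' => //; exact: close_sym.
by have [la' l' c] := h1 _ l; exists la' => //; exact: close_sym.
Qed.

Lemma near_pts_trans x e e' w w' w'' : near_pts x e w w' -> near_pts x e' w' w'' ->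
  near_pts x (e + e') w w''.
Proof.
move=> [h1 h2] [k1 k2]; split=> la l.
  have [la' l' c'] := h1 _ l; have [la'' l'' c''] := k1 _ l'.
  by exists la'' => //; exact: close_trans c' c''.
have [la' l' c'] := k2 _ l; have [la'' l'' c''] := h2 _ l'.
by exists la'' => //; exact: close_trans c'' c'.
Qed.

Lemma near_ptsW x e e' w w' : e <= e' -> near_pts x e w w' -> near_pts x e' w w'.
Proof.
move=> ee' [h1 h2]; split=> la l.
  by have [la' l' c] := h1 _ l; exists la' => //; exact: closeW c.
by have [la' l' c] := h2 _ l; exists la' => //; exact: closeW c.
Qed.

Lemma near_pts_refl x e w : 0 <= e -> near_pts x e w w.
Proof. by move=> e0; split=> la l; exists la => //; exact: close_refl. Qed.

Lemma near_pts_simplex x n (c : chain G n) (t t' : simplex n) (eta : R) :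
  (forall k, `|set_val t ord0 k - set_val t' ord0 k| <= eta) ->
  near_pts x ((n.+2 * n.+1)%:R * eta)
    (realization_pt (c : nerve G n) t) (realization_pt (c : nerve G n) t').
Proof.
move=> h; have cl := step_close h; split=> la /lift_cone [m cm ->].
  exists (fun s => m (step (set_val t') s)); [exact: cone_lift|exact: close_comp].
exists (fun s => m (step (set_val t) s)); [exact: cone_lift|exact: close_comp].
Qed.

Lemma near_pts_nbhs x e w : 0 < e -> \forall w' \near w, near_pts x e w w'.
Proof.
(* The strict bound [e' < e] leaves room for a further small move in every simplex, which makes [U]
   open. *)
move=> e0; pose U := [set w' | exists2 e', e' < e & near_pts x e' w w'].
have oU : open U.
  apply: realization_open => n c; rewrite openE => t [e' ee' nt].
  (* The factor in [step_close] turns [eta] into (e - e') / 2. *)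
  pose eta := (e - e') / 2 / (n.+2 * n.+1)%:R.
  have eta0 : 0 < eta by rewrite !divr_gt0// subr_gt0.
  have near_k k : nbhs t [set t' : simplex n | `|set_val t ord0 k - set_val t' ord0 k| < eta].
    have /cvgrPdist_lt := @simplex_coord_continuous R n k t.
    exact.
  have := filter_forall (nbhs_filter t) near_k.
  apply: filterS => t' ht; exists (e' + (n.+2 * n.+1)%:R * eta).
    have -> : (n.+2 * n.+1)%:R * eta = (e - e') / 2.
      by rewrite mulrC divfK.
    lra.
  apply: near_pts_trans nt _; apply: near_pts_simplex => k.
  exact/ltW/ht.
have Uw : U w by exists 0 => //; exact: near_pts_refl.
have : nbhs w U by exact: open_nbhs_nbhs.
by apply: filterS => w' [e' /ltW ee']; exact: near_ptsW.
Qed.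

(** A Lebesgue number argument: nearby points share a centre, from whose image each of their images
    is within e / 2. *)
Lemma near_pts_uniform x e (V : pseudoMetricType R) (K : set V) (H : V -> BG) :
  0 < e -> compact K -> continuous H -> exists2 delta, 0 < delta &
  forall k k', K k -> ball k delta k' -> near_pts x e (H k) (H k').
Proof.
move=> e0 cK cH.
pose P (delta : R) (k : V) := forall k', ball k delta k' -> near_pts x e (H k) (H k').
have /compact_near_coveringP cov := cK.
have : \forall d \near (0 : R)^'+, K `<=` P d.
  apply: cov => k _.
  have e2 : 0 < e / 2 by rewrite divr_gt0.
  have := cH k _ (near_pts_nbhs x (H k) e2).
  rewrite /= => /nbhs_ballP [r /= r0 hr].
  exists (ball k (r / 2), [set d | d < r / 2]) => /=.
    split; first by apply: nbhsx_ballx; rewrite divr_gt0.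
    by apply: nbhs_right_lt; rewrite divr_gt0.
  move=> [k1 d] /= [bk1 dr] k2 bk2; rewrite [e]splitr.
  apply: (@near_pts_trans _ _ _ _ (H k)).
    apply/near_pts_sym/hr; apply: le_ball bk1.
    by lra.
  apply: hr; rewrite [r]splitr; apply: ball_triangle bk1 _.
  by apply: le_ball bk2; exact: ltW.
move=> near_d; near (0 : R)^'+ => d.
exists d; first by near: d; exact: nbhs_right_gt.
have Kd : K `<=` P d by near: d.
by move=> k k' /Kd; apply.
Unshelve. all: by end_near.
Qed.

End lifts.

(** * Lifting of paths and squares *)

Section lifting.
Context {R : realType} (G : groupoid).
Local Notation BG := (realization R (nerve G)).
(* Four successive errors must stay below 1, the distance of distinct lifts. *)
Let tol : R := 8%:R^-1.

(** Each point [k] is reached along its segment from the origin in [N] steps, with independent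
    choices; uniqueness of close lifts makes these fit together. *)
Lemma lift_square (x : G) (H : R * R -> BG) la0 : continuous H ->
  is_lift x (H (0, 0)) la0 -> exists S : R * R -> R -> arrow G,
  [/\ forall k : R * R, 0 <= k.1 <= 1 -> 0 <= k.2 <= 1 -> is_lift x (H k) (S k),
      S (0, 0) = la0 &
      exists2 delta : R, 0 < delta & forall k k' : R * R, 0 <= k.1 <= 1 -> 0 <= k.2 <= 1 ->
        0 <= k'.1 <= 1 -> 0 <= k'.2 <= 1 -> ball k delta k' -> close tol (S k) (S k')].
Proof.
move=> cH l0.
have tol0 : 0 < tol by rewrite invr_gt0.
pose K : set (R * R) := [set k | 0 <= k.1 <= 1 /\ 0 <= k.2 <= 1].
have cK : compact K.
  have -> : K = `[0, 1] `*` `[0, 1].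
    by apply/seteqP; split=> -[a b] /=; rewrite !in_itv.
  by apply: compact_setX; exact: segment_compact.
have [d d0 hd] := near_pts_uniform x tol0 cK cH.
pose N := (Num.trunc d^-1).+1.
have N0 : 0 < N%:R :> R by rewrite ltr0n.
have Nd : N%:R^-1 < d.
  rewrite invf_plt ?posrE//.
  by apply: truncnS_gt.
pose pos (k : R * R) (i : nat) : R * R := (i%:R / N%:R * k.1, i%:R / N%:R * k.2).
have posK k i : K k -> (i <= N)%N -> K (pos k i).
  have h (u : R) : 0 <= u <= 1 -> (i <= N)%N -> 0 <= i%:R / N%:R * u <= 1.
    move=> /andP[u0 u1] iN; have q0 : 0 <= i%:R / N%:R :> R by rewrite divr_ge0.
    rewrite mulr_ge0//= mulr_ile1// ler_pdivrMr// mul1r ler_nat//.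
  by move=> [k1 k2] iN; split; exact: h.
have pos_step k i : K k -> ball (pos k i) d (pos k i.+1).
  have h (u : R) : 0 <= u <= 1 -> `|i%:R / N%:R * u - i.+1%:R / N%:R * u| < d.
    move=> /andP[u0 u1]; rewrite -mulrBl -mulrBl -natr1 opprD addNKr mulN1r mulNr normrN.
    apply: le_lt_trans Nd; rewrite ger0_norm ?mulr_ge0 ?invr_ge0 ?ler0n//.
    by rewrite ler_piMr// invr_ge0.
  by move=> [k1 k2]; split; rewrite /ball/=; exact: h.
have pos_ball k k' i : (i <= N)%N -> ball k d k' -> ball (pos k i) d (pos k' i).
  have h (u u' : R) : (i <= N)%N -> `|u - u'| < d -> `|i%:R / N%:R * u - i%:R / N%:R * u'| < d.
    move=> iN uu; rewrite -mulrBr normrM; apply: le_lt_trans uu.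
    by rewrite ler_piMl// ger0_norm ?divr_ge0// ler_pdivrMr// mul1r ler_nat.
  by move=> iN [b1 b2]; split; rewrite /ball/=; apply: h.
(* The premises stand under the existential so that [nx] is total; [la] itself is the junk value. *)
have next k i la : exists la', K k -> (i < N)%N -> is_lift x (H (pos k i)) la ->
    is_lift x (H (pos k i.+1)) la' /\ close tol la la'.
  have [[Kk [iN l]]|no] := pselect (K k /\ (i < N)%N /\ is_lift x (H (pos k i)) la); last first.
    by exists la => Kk iN l; case: no.
  have [h _] := hd _ _ (posK _ _ Kk (ltnW iN)) (pos_step _ i Kk).
  by have [la' l' c] := h _ l; exists la'.
pose nx k i la := projT1 (cid (next k i la)).
pose S := fix S k i := if i is j.+1 then nx k j (S k j) else la0.
have p0 k : pos k 0%N = (0, 0) by rewrite /pos !mul0r.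
have Sl k i : K k -> (i <= N)%N -> is_lift x (H (pos k i)) (S k i).
  move=> Kk; elim: i => [|i IH] iN; first by rewrite p0.
  by have [] := projT2 (cid (next k i (S k i))) Kk iN (IH (ltnW iN)).
have Sc k i : K k -> (i < N)%N -> close tol (S k i) (S k i.+1).
  move=> Kk iN.
  by have [] := projT2 (cid (next k i (S k i))) Kk iN (Sl _ _ Kk (ltnW iN)).
have K0 : K (0, 0) by rewrite /K/= lexx ler01.
have posN k : pos k N = k by rewrite /pos divff ?gt_eqF// !mul1r -surjective_pairing.
exists (fun k => S k N); split.
- by move=> k k1 k2; rewrite -{1}(posN k); exact: Sl.
- have : forall i, (i <= N)%N -> S (0, 0) i = la0.
    elim=> [//|i IH] iN; rewrite -(IH (ltnW iN)).
    (* The segment to the origin is constant, so successive lifts are close lifts of one point,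
       hence equal. *)
    have z j : pos (0, 0) j = (0, 0) by rewrite /pos !mulr0.
    have := Sl _ _ K0 iN; have := Sl _ _ K0 (ltnW iN); rewrite !z => l l'.
    apply: (lift_close_eq _ l' l (close_sym (Sc _ _ K0 iN))).
    by rewrite /tol invf_lt1// ltr1n.
  exact.
- exists d => // k k' k1 k2 k1' k2' b.
  have Kk : K k by []. have Kk' : K k' by [].
  have : forall i, (i <= N)%N -> close tol (S k i) (S k' i); last exact.
  elim=> [_|i IH iN]; first exact: close_refl (ltW tol0).
  have [h _] := hd _ _ (posK _ _ Kk iN) (pos_ball _ _ _ iN b).
  have [la l c] := h _ (Sl _ _ Kk iN).
  (* The chain is [la], [S k i.+1], [S k i], [S k' i], [S k' i.+1]: four errors of 1/8, so [la] is
     the lift already chosen at [k']. *)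
  have e := close_trans (close_trans (close_trans (close_sym c) (close_sym (Sc _ _ Kk iN)))
    (IH (ltnW iN))) (Sc _ _ Kk' iN).
  rewrite -(lift_close_eq _ l (Sl _ _ Kk' iN) e)//.
  by rewrite /tol; lra.
Qed.

(** Continuity up to the single tolerance [tol] is enough: lifts of one point are equal or differ
    everywhere. *)
Definition path_lift (x : G) (p : R -> BG) (S : R -> R -> arrow G) : Prop :=
  (forall u : R, 0 <= u <= 1 -> is_lift x (p u) (S u)) /\
  exists2 delta : R, 0 < delta & forall u u' : R, 0 <= u <= 1 -> 0 <= u' <= 1 ->
    `|u - u'| < delta -> close tol (S u) (S u').

Lemma path_lift_cst x w la : is_lift x w la -> path_lift x (fun=> w) (fun=> la).
Proof.
by move=> l; split=> //; exists 1 => // *; apply: close_refl; rewrite invr_ge0.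
Qed.

(** Agreement propagates over pieces shorter than both moduli, as the next values lie over one point
    and within 2 [tol] < 1 of each other. *)
Lemma path_lift_uniq x p S S' : path_lift x p S -> path_lift x p S' ->
  S 0 = S' 0 -> S 1 = S' 1.
Proof.
move=> [l [d d0 c]] [l' [d' d0' c']] e0.
pose N := (maxn (Num.trunc d^-1) (Num.trunc d'^-1)).+1.
have N0 : 0 < N%:R :> R by rewrite ltr0n.
have Nd (e : R) : 0 < e -> ((Num.trunc e^-1) < N)%N -> N%:R^-1 < e.
  move=> e1 eN; rewrite invf_plt ?posrE//; apply: lt_le_trans (truncnS_gt _) _.
  by rewrite ler_nat.
have u01 i : (i <= N)%N -> 0 <= (i%:R / N%:R : R) <= 1.
  by move=> iN; rewrite divr_ge0//= ler_pdivrMr// mul1r ler_nat.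
have dist i : `|i.+1%:R / N%:R - i%:R / N%:R| = N%:R^-1 :> R.
  by rewrite -mulrBl -natrB// subSnn mul1r ger0_norm// invr_ge0.
have : forall i, (i <= N)%N -> S (i%:R / N%:R) = S' (i%:R / N%:R).
  elim=> [_|i IH iN]; first by rewrite mul0r.
  have c1 := c _ _ (u01 _ iN) (u01 _ (ltnW iN)).
  have c2 := c' _ _ (u01 _ iN) (u01 _ (ltnW iN)).
  rewrite dist in c1; rewrite dist in c2.
  rewrite IH ?(ltnW iN)// in c1.
  have e := close_trans (c1 (Nd _ d0 (leq_maxl _ _))) (close_sym (c2 (Nd _ d0' (leq_maxr _ _)))).
  apply: (lift_close_eq _ (l _ (u01 _ iN)) (l' _ (u01 _ iN)) e).
  by rewrite /tol; lra.
by move=> /(_ N (leqnn _)); rewrite divff ?gt_eqF.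
Qed.

End lifting.

(** * Equivalences of groupoids from weak equivalences of nerves *)

Section edges.
Context {R : realType}.
Local Notation simplex n := (set_type (@top_simplex R n)).

Lemma simplex0_subproof : (const_mx 1 : 'rV[R]_1) \in @top_simplex R 0.
Proof.
apply/mem_set; split=> [i|]; first by rewrite mxE ler01.
by rewrite big_ord1 mxE.
Qed.

Definition simplex0 : simplex 0 :=
  exist (fun t => t \in @top_simplex R 0) _ simplex0_subproof.

Lemma simplex0_uniq (t : simplex 0) : t = simplex0.
Proof.
apply: simplex_ext => i; have [_] := simplexP t; rewrite big_ord1 (ord1 i) => ->.
by rewrite /= mxE.
Qed.

Lemma chain_of_cone (G : groupoid) n (m : 'I_n.+1 -> arrow G) :
  (forall i j, src (m i) = src (m j)) ->
  exists c : chain G n, forall i j, carr c i j = acomp (m j) (ainv (m i)).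
Proof.
move=> ms; apply: (chain_build (ob := fun i => tgt (m i))) => [i j|i j|i|i j k].
- by rewrite src_acomp.
- by rewrite tgt_acomp// tgt_ainv.
- by rewrite acompVr.
- rewrite -acompA ?src_acomp ?tgt_acomp ?tgt_ainv//.
  by rewrite (@acompA _ (ainv (m j)))// ?tgt_ainv// acompVl acomp_idl// tgt_ainv.
Qed.

Section one_groupoid.
Context (G : groupoid).
Local Notation BG := (realization R (nerve G)).

Lemma vertex_ex (x : G) : exists c : chain G 0, forall i j, carr c i j = aid x.
Proof.
have [c cE] := @chain_of_cone G 0 (fun=> aid x) (fun _ _ => erefl).
by exists c => i j; rewrite cE ainv_id acomp_idl.
Qed.

Definition vertex_chain (x : G) : chain G 0 := projT1 (cid (vertex_ex x)).

Lemma carr_vertex x i j : carr (vertex_chain x) i j = aid x.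
Proof. exact: (projT2 (cid (vertex_ex x))). Qed.

Definition vertex (x : G) : BG := realization_pt (vertex_chain x : nerve G 0) simplex0.

(** The dimension is written [0 + 1] to match the join of two 0-simplices, whose segment [join_pt]
    parametrizes the edge. *)
Definition edge_arrow (m : arrow G) (i : 'I_(0 + 1).+1) : arrow G :=
  if i == ord0 then aid (src m) else m.

Lemma edge_ex (m : arrow G) : exists c : chain G (0 + 1),
  forall i j, carr c i j = acomp (edge_arrow m j) (ainv (edge_arrow m i)).
Proof.
by apply: chain_of_cone => i j; rewrite /edge_arrow; do 2![case: ifP].
Qed.

Definition edge_chain (m : arrow G) : chain G (0 + 1) := projT1 (cid (edge_ex m)).

Lemma carr_edge m i j :
  carr (edge_chain m) i j = acomp (edge_arrow m j) (ainv (edge_arrow m i)).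
Proof. exact: (projT2 (cid (edge_ex m))). Qed.

Lemma src_edge_arrow m i : src (edge_arrow m i) = src m.
Proof. by rewrite /edge_arrow; case: ifP. Qed.

Lemma edge_cone m : is_cone (src m) (edge_chain m) (edge_arrow m).
Proof.
split=> [i|i|i j]; first exact: src_edge_arrow.
- by rewrite -(src_carr (edge_chain m) i i) carr_edge src_acomp.
- by rewrite carr_edge -acompA ?tgt_ainv// ?src_edge_arrow// acompVl acomp_idr// !src_edge_arrow.
Qed.

Definition edge_path (m : arrow G) (u : R) : BG :=
  realization_pt (edge_chain m : nerve G (0 + 1)) (join_pt u simplex0).

Lemma edge_path_continuous m : continuous (edge_path m).
Proof.
have c : continuous (fun u : R => join_pt u simplex0).
  have pc : continuous (fun u : R => (simplex0, u)).
    by apply: (pair_continuous (f := fun=> simplex0)); [exact: cst_continuous|exact: id_continuous].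
  exact: (comp_continuous (@join_pt_continuous R 0) pc).
have c' := @realization_pt_continuous R (nerve G) _ (edge_chain m : nerve G (0 + 1)).
exact: comp_continuous c' c.
Qed.

Lemma edge_path0 m : edge_path m 0 = vertex (src m).
Proof.
rewrite /edge_path join_pt0 -realization_pt_sact /vertex; congr realization_pt.
apply: chain_ext => i j.
by rewrite [LHS]carr_act carr_edge carr_vertex !ord1 /edge_arrow /= ainv_id acomp_idl.
Qed.

Lemma edge_path1 m : edge_path m 1 = vertex (tgt m).
Proof.
rewrite /edge_path join_pt1 -realization_pt_sact /vertex; congr realization_pt.
apply: chain_ext => i j.
by rewrite [LHS]carr_act carr_edge carr_vertex !ord1 /edge_arrow /= acompVr.
Qed.

Lemma edge_path_aid x u : edge_path (aid x) u = vertex x.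
Proof.
have e : edge_arrow (aid x) =1 (fun=> aid x).
  by move=> i; rewrite /edge_arrow; case: ifP.
pose a : omap (0 + 1) 0 := @Omap (0 + 1) 0 (fun=> ord0) (fun _ _ _ => leqnn _).
have ec : (edge_chain (aid x) : nerve G (0 + 1)) = sact a (vertex_chain x : nerve G 0).
  apply: chain_ext => i j.
  by rewrite carr_edge !e [RHS]carr_act carr_vertex ainv_id acomp_idl.
by rewrite /edge_path ec realization_pt_sact (simplex0_uniq (top_simplex_map _ _)).
Qed.

Lemma vertex_lift x (m : arrow G) : src m = x -> forall y, tgt m = y ->
  is_lift x (vertex y : BG) (fun=> m).
Proof.
move=> mx y my; have c : is_cone x (vertex_chain y) (fun=> m).
  split=> // [i|i j]; last by rewrite carr_vertex acomp_idl.
  by rewrite my -(src_carr _ i i) carr_vertex.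
exact: (@cone_lift R G 0 x (vertex_chain y) (fun=> m) simplex0 c).
Qed.

Lemma pt_ob_vertex y s : pt_ob (vertex y : BG) s = y.
Proof. by rewrite /pt_ob transitionE carr_vertex. Qed.

(** It runs from the identity of [src m] to [m], so the end of the lift recovers the arrow from its
    path. *)
Definition edge_lift (m : arrow G) (u : R) (s : R) : arrow G :=
  edge_arrow m (step (set_val (join_pt u simplex0)) s).

Lemma edge_path_lift m : path_lift (src m) (edge_path m) (edge_lift m).
Proof.
split=> [u u01|]; first exact: cone_lift (edge_cone m).
(* On a 1-simplex the factor in [step_close] is 3 * 2 = 6, and 6 / 48 is the tolerance 1/8. *)
exists (48%:R^-1) => [|u u' u01 u01' uu]; first by rewrite invr_gt0.
have h k : `|set_val (join_pt u simplex0) ord0 k - set_val (join_pt u' simplex0) ord0 k| <= 48%:R^-1.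
  move: k; apply: (@joinP 0) => k.
    rewrite !set_val_join_ptl !mxE !mulr1 !clamp_id// opprB addrC addrA subrK distrC.
    exact: ltW.
  by rewrite !set_val_join_ptr !mxE !mulr1 !clamp_id//; exact: ltW.
apply: close_comp; apply: closeW (step_close h).
by rewrite /=; lra.
Qed.

Lemma edge_lift0 m : edge_lift m 0 = fun=> aid (src m).
Proof.
apply: funext => s; rewrite /edge_lift join_pt0 step_map !ord1.
by rewrite /edge_arrow.
Qed.

Lemma edge_lift1 m : edge_lift m 1 = fun=> m.
Proof.
apply: funext => s; rewrite /edge_lift join_pt1 step_map !ord1.
by rewrite /edge_arrow.
Qed.

(** The path is lifted as a square that is constant in its first coordinate. *)
Lemma lift_path x (p : R -> BG) la : continuous p -> is_lift x (p 0) la ->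
  exists2 S, path_lift x p S & S 0 = la.
Proof.
move=> cp l0.
have [S [Sl S0 [d d0 Sd]]] := lift_square (comp_continuous cp (@snd_continuous R R)) l0.
have z01 : 0 <= (0 : R) <= 1 by rewrite lexx ler01.
exists (fun u => S (0, u)) => //; split=> [u u01|]; first exact: (Sl (0, u)).
exists d => // u u' u01 u01' uu; apply: Sd => //.
by split; rewrite /ball/= ?subrr ?normr0.
Qed.

(* Lifting the homotopy over the square, the sides over the base point are
   constant. *)
Lemma homotopic_lifts x y (L : R * R -> BG) la Sa Sb : continuous L ->
  (forall t, L (t, 0) = vertex y) -> (forall t, L (t, 1) = vertex y) ->
  path_lift x (fun u => L (0, u)) Sa -> path_lift x (fun u => L (1, u)) Sb ->
  Sa 0 = la -> Sb 0 = la -> Sa 1 = Sb 1.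
Proof.
move=> cL L0 L1 la_a la_b a0 b0.
have z01 : 0 <= (0 : R) <= 1 by rewrite lexx ler01.
have o01 : 0 <= (1 : R) <= 1 by rewrite lexx ler01.
have l0 : is_lift x (L (0, 0)) la by rewrite -a0; exact: la_a.1.
have [S [Sl S0 [d d0 Sd]]] := lift_square cL l0.
have row t : 0 <= t <= 1 -> path_lift x (fun u => L (t, u)) (fun u => S (t, u)).
  move=> t01; split=> [u u01|]; first exact: (Sl (t, u)).
  exists d => // u u' u01 u01' uu; apply: Sd => //.
  by split; rewrite /ball/= ?subrr ?normr0.
have col u : 0 <= u <= 1 -> path_lift x (fun t => L (t, u)) (fun t => S (t, u)).
  move=> u01; split=> [t t01|]; first exact: (Sl (t, u)).
  exists d => // t t' t01 t01' tt; apply: Sd => //.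
  by split; rewrite /ball/= ?subrr ?normr0.
have const u : 0 <= u <= 1 -> (forall t, L (t, u) = vertex y) -> S (0, u) = S (1, u).
  move=> u01 Lu; have := col _ u01.
  under eq_fun do rewrite Lu.
  move=> c; apply/esym.
  apply: (path_lift_uniq c (path_lift_cst (w := vertex y) (la := S (0, u)) _)) => //.
  by rewrite -(Lu 0); exact: (Sl (0, u)).
have ea : Sa 1 = S (0, 1) by apply: (path_lift_uniq la_a (row _ z01)); rewrite a0 S0.
have eb : Sb 1 = S (1, 1).
  by apply: (path_lift_uniq la_b (row _ o01)); rewrite b0 -(const 0)// S0.
by rewrite ea eb (const 1).
Qed.

End one_groupoid.
End edges.

(** * Fullness, faithfulness and essential surjectivity *)

Section nerve_weak_equivalence.
Context {R : realType} (G H : groupoid) (F : gfunctor G H).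
Local Notation BF := (@realization_map R (nerve G) (nerve H) (nerve_map F)).

Lemma realization_map_vertex x : BF (vertex x) = vertex (F x).
Proof.
rewrite /vertex realization_map_pt; congr realization_pt.
by apply: chain_ext => i j; rewrite [LHS]carr_map !carr_vertex amap_id.
Qed.

Lemma realization_map_edge m u : BF (edge_path m u) = edge_path (amap F m) u.
Proof.
rewrite /edge_path realization_map_pt; congr realization_pt.
have e i : amap F (edge_arrow m i) = edge_arrow (amap F m) i.
  by rewrite /edge_arrow; case: ifP; rewrite ?amap_id.
apply: chain_ext => i j; rewrite [LHS]carr_map !carr_edge amap_comp ?amap_inv ?e//.
by rewrite tgt_ainv !src_edge_arrow.
Qed.

Lemma transition_map w s s' : transition (BF w) s s' = amap F (transition w s s').
Proof.
by move: w; apply: realizationP => n c t; rewrite realization_map_pt !transitionE carr_map.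
Qed.

Lemma lift_map x w la : is_lift x w la -> is_lift (F x) (BF w) (fun s => amap F (la s)).
Proof.
move=> [ls lt lc]; split=> [s|s|s s'].
- by rewrite src_amap ls.
- by rewrite tgt_amap lt /pt_ob transition_map src_amap.
- by rewrite transition_map (lc s s') amap_comp// lt src_transition.
Qed.

Lemma path_lift_map x p S : path_lift x p S ->
  path_lift (F x) (fun u => BF (p u)) (fun u s => amap F (S u s)).
Proof.
move=> [l [d d0 c]]; split=> [u u01|]; first exact/lift_map/l.
by exists d => // u u' u01 u01' uu; apply: close_comp; exact: c.
Qed.

Lemma spheroid1 (T : topologicalType) (x : T) (p : R -> T) : continuous p ->
  p 0 = x -> p 1 = x -> spheroid x (fun s : 'rV[R]_1 => p (s ord0 ord0)).
Proof.
move=> cp p0 p1; apply: spheroidI.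
  apply: (comp_continuous cp); exact: coord_continuous.
by move=> s [_ [i]]; rewrite (ord1 i) => -[->|->].
Qed.

Lemma const_mx_cube (u : R) : 0 <= u <= 1 -> cube 1 (const_mx u : 'rV[R]_1).
Proof. by move=> u01 i; rewrite mxE. Qed.

Lemma const_mx_continuous : continuous (fun u : R => const_mx u : 'rV[R]_1).
Proof. by apply: rV_continuous => i; under eq_fun do rewrite mxE; exact: id_continuous. Qed.

Lemma path_lift_ext (K : groupoid) x (p p' : R -> realization R (nerve K)) S :
  (forall u, 0 <= u <= 1 -> p u = p' u) -> path_lift x p S -> path_lift x p' S.
Proof. by move=> e [l c]; split=> // u u01; rewrite -e//; exact: l. Qed.

Lemma spheroid_homotopic_lifts (K : groupoid) x y (a b : 'rV[R]_1 -> realization R (nerve K))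
    la Sa Sb : spheroid_homotopic (vertex y) a b ->
  path_lift x (fun u => a (const_mx u)) Sa -> path_lift x (fun u => b (const_mx u)) Sb ->
  Sa 0 = la -> Sb 0 = la -> Sa 1 = Sb 1.
Proof.
move=> /spheroid_homotopicE [L [cL L0 L1 Lx]] la_a la_b.
have cL' : continuous (fun k : R * R => L (k.1, const_mx k.2)).
  apply: (comp_continuous cL); apply: pair_continuous; first exact: fst_continuous.
  exact: (comp_continuous const_mx_continuous (@snd_continuous _ _)).
have bd (u : R) : u = 0 \/ u = 1 -> cube_boundary 1 (const_mx u : 'rV[R]_1).
  move=> h; split; last by exists ord0; rewrite mxE.
  by apply: const_mx_cube; case: h => ->; rewrite ?lexx ?ler01.
apply: (homotopic_lifts cL' (y := y)) => [t|t||].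
- by rewrite /= Lx//; apply: bd; left.
- by rewrite /= Lx//; apply: bd; right.
- by apply: path_lift_ext la_a => u u01; rewrite /= L0//; exact: const_mx_cube.
- by apply: path_lift_ext la_b => u u01; rewrite /= L1//; exact: const_mx_cube.
Qed.

(** The path is lifted from the identity of [x]; the end of the lift consists of arrows from [x] to
    the objects of [w]. *)
Lemma path_joined_arrow (K : groupoid) (x : K) w :
  path_joined (R := R) (vertex x) (w : realization R (nerve K)) ->
  exists la, is_lift x w la.
Proof.
move=> /path_joinedE [p [cp p0 p1]].
have l0 : is_lift x (p 0) (fun=> aid x) by rewrite p0; exact: vertex_lift.
have [S [Sl _] _] := lift_path cp l0.
by exists (S 1); rewrite -p1; apply: Sl; rewrite ler01 lexx.
Qed.

Lemma edge_joined (K : groupoid) (m : arrow K) :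
  path_joined (R := R) (@vertex R K (src m)) (@vertex R K (tgt m)).
Proof.
by have := path_joinedI (@edge_path_continuous R K m); rewrite edge_path0 edge_path1.
Qed.

Lemma weak_equivalence_nerve : weak_equivalence R (nerve_map F) ->
  [/\ full F, faithful F & essentially_surjective F].
Proof.
move=> [cF injF surjF piF].
have loop (K : groupoid) (m : arrow K) x : src m = x -> tgt m = x ->
    spheroid (vertex x) (fun s : 'rV[R]_1 => edge_path m (s ord0 ord0)).
  move=> mx my; apply: spheroid1; first exact: edge_path_continuous.
    by rewrite edge_path0 mx.
  by rewrite edge_path1 my.
have loop_lift (K : groupoid) (m : arrow K) x : src m = x ->
    path_lift x (fun u => edge_path m ((const_mx u : 'rV[R]_1) ord0 ord0)) (edge_lift m).
  move=> <-; apply: path_lift_ext (edge_path_lift m) => u u01.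
  by rewrite mxE.
split.
- move=> x y h.
  (* Injectivity on path components yields only some arrow [k] from [x] to [y], still to be
     corrected by a loop. *)
  have : path_joined (R := R) (@vertex R G x) (@vertex R G y).
    apply: injF; rewrite !realization_map_vertex; exact: (edge_joined (arr h)).
  move=> /path_joined_arrow [la [/(_ 0) ls /(_ 0) lt _]].
  rewrite pt_ob_vertex in lt.
  have [k _] := arr_srcP ls lt.
  (* The defect of [F k] is a loop at [F x]. Surjectivity on the first homotopy group provides a
     loop [a] over it, whose lift ends in an arrow that [F] sends to [c]. *)
  pose c := gcomp (ginv (fmor F k)) h.
  have [_ surj1] := piF 1%N (vertex x) isT.
  have sc : spheroid (BF (vertex x)) (fun s : 'rV[R]_1 => edge_path (arr c) (s ord0 ord0)).
    by rewrite realization_map_vertex; exact: loop.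
  have [a sa] := surj1 _ sc.
  rewrite realization_map_vertex => hac.
  have cube_a u : 0 <= u <= 1 -> cube_clamp (const_mx u : 'rV[R]_1) = const_mx u.
    by move=> u01; rewrite cube_clamp_id//; exact: const_mx_cube.
  have bd (u : R) : u = 0 \/ u = 1 -> a (const_mx u) = vertex x.
    move=> hu; apply: sa.2; split; last by exists ord0; rewrite mxE.
    by apply: const_mx_cube; case: hu => ->; rewrite ?lexx ?ler01.
  have cp := comp_continuous (spheroid_continuous sa) const_mx_continuous.
  have l0 : is_lift x ((a \o @cube_clamp R 1) (const_mx 0)) (fun=> aid x).
    rewrite /= cube_a ?lexx ?ler01// bd; last by left.
    exact: vertex_lift.
  have [S pS S0] := lift_path cp l0.
  have pS' : path_lift x (fun u => a (const_mx u)) S.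
    by apply: path_lift_ext pS => u u01; rewrite /= cube_a.
  (* The image of the lift of [a] and the lift of the edge loop of [c] both start at the identity,
     over homotopic loops, so they end at the same arrow. *)
  have := spheroid_homotopic_lifts hac (path_lift_map pS') (loop_lift _ (arr c) _ erefl).
  move=> /(_ (fun=> aid (F x))) e.
  have {e} := e _ (edge_lift0 _); rewrite S0 edge_lift1.
  have -> : (fun s : R => amap F (aid x)) = fun=> aid (F x).
    by apply: funext => s; rewrite amap_id.
  move=> /(_ erefl) /(congr1 (fun la => la 0)) /= e.
  have [] := pS'.1 1; first by rewrite ler01 lexx.
  rewrite bd; last by right.
  move=> /(_ 0) s1 /(_ 0); rewrite pt_ob_vertex => t1 _.
  have [n nE] := arr_srcP s1 t1.
  exists (gcomp k n); rewrite fmor_comp.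
  rewrite nE in e; rewrite (arr_inj e).
  by rewrite /c gcompA gcomp_inv gid_comp.
(* The edge loop of [m] has constant image, so by injectivity on the first homotopy group it is
   homotopic to the constant loop, and the ends [m] and identity of the two lifts agree. *)
- move=> x y h k hk; pose m := gcomp (ginv k) h.
  have Fm : amap F (arr m) = aid (F x).
    rewrite /m -acompE amap_comp// -/(ainv (arr k)) amap_inv !amap_arr hk.
    by rewrite acompVl.
  have [inj1 _] := piF 1%N (vertex x) isT.
  have hm := inj1 _ _ (loop _ (arr m) x erefl erefl) (loop _ (aid x) x erefl erefl).
  have {hm} := hm _.
  have -> : BF \o (fun s : 'rV[R]_1 => edge_path (arr m) (s ord0 ord0)) = fun=> BF (vertex x).
    apply: funext => s; rewrite /= realization_map_edge Fm edge_path_aid.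
    by rewrite realization_map_vertex.
  have -> : BF \o (fun s : 'rV[R]_1 => edge_path (aid x) (s ord0 ord0)) = fun=> BF (vertex x).
    by apply: funext => s; rewrite /= edge_path_aid.
  move=> hm; have {hm} : spheroid_homotopic (vertex x)
      (fun s : 'rV[R]_1 => edge_path (arr m) (s ord0 ord0))
      (fun s : 'rV[R]_1 => edge_path (aid x) (s ord0 ord0)).
    apply: hm; apply: (spheroid_homotopicI (L := fun=> BF (vertex x))) => //.
    exact: cst_continuous.
  move=> /spheroid_homotopic_lifts /(_ (loop_lift _ (arr m) _ erefl) (loop_lift _ (aid x) _ erefl)).
  move=> /(_ _ (edge_lift0 _) (edge_lift0 _)).
  rewrite !edge_lift1 => /(congr1 (fun la => la 0)) /= /arr_inj me.
  by rewrite -[h]gid_comp -(gcomp_inv k) -gcompA -/m me gcomp_id.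
(* The lift at parameter 0 is an arrow from [y] to an object of the image of [z], hence to a value
   of [F]. *)
- move=> y; have [z /path_joined_sym hz] := surjF (vertex y).
  have [la l] := path_joined_arrow hz.
  move: z hz l; apply: realizationP => n c t _; rewrite realization_map_pt.
  move=> [/(_ 0) ls /(_ 0) lt _].
  move: lt; rewrite /pt_ob transitionE carr_map src_amap => lt.
  have [k _] := arr_srcP ls lt.
  by exists (src (carr c (step (set_val t) 0) (step (set_val t) 0))); split; exact: (ginv k).
Qed.

End nerve_weak_equivalence.

Theorem corollary14 (R : realType) (G H : cosimp_groupoid) (f : cg_map G H)
    (weq_f : cg_weak_equivalence R f) :
  weak_equivalence R
    (cs_hom_map cosimp_simplex (cosimp_nerve_map f)
      : smap (cs_hom cosimp_simplex (cosimp_nerve G))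
             (cs_hom cosimp_simplex (cosimp_nerve H))).
Proof.
have eqv l := weak_equivalence_nerve (weq_f l).
have full_f l : full (f l) by case: (eqv l).
have faithful_f l : faithful (f l) by case: (eqv l).
have surj_f : essentially_surjective (f 0%N) by case: (eqv 0%N).
have [g [J [K [hJ hK fJ]]]] := tot_homotopy_inverse full_f faithful_f surj_f.
exact: realized_homotopy_equivalence hJ hK fJ.
Qed.
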